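(* Let $\alpha\in(0,1)$, $\theta,\gamma>0$, and let $\overline{\mathcal{Y}}_\alpha=\{\overline{\mathcal{Y}}_\alpha(t),t\ge0\}$ be the centered stationary Gaussian process with covariance $$r(s)=\mathrm{Cov}\big(\overline{\mathcal{Y}}_\alpha(t),\overline{\mathcal{Y}}_\alpha(t+s)\big)=\frac{\theta}{\gamma}E_{\alpha,1}(-\gamma|s|^\alpha).$$ Then $\overline{\mathcal{Y}}_\alpha$ exhibits long-range dependence (of order $1-\alpha$), both in the covariance and in the spectral density sense: there is a constant $C_\alpha>0$ such that $$r(s)\sim C_\alpha s^{-\alpha}\qquad (s\to+\infty),$$ and its spectral density $\mathcal{S}_{\overline{\mathcal{Y}}_\alpha}$ satisfies $$\mathcal{S}_{\overline{\mathcal{Y}}_\alpha}(\omega)=O(|\omega|^{\alpha-1})\qquad (|\omega|\to0).$$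
   Context: $E_{\beta,\delta}(x)=\sum_{j=0}^\infty \frac{x^j}{\Gamma(\beta j+\delta)}$ is the two-parameter Mittag-Leffler function. The spectral density of a stationary process with covariance function $r$ is $\mathcal{S}(\omega)=\frac{1}{2\pi}\int_{-\infty}^{+\infty}e^{-i\omega s}r(s)\,ds$, $\omega\neq0$, understood as an improper integral when $r$ is not absolutely integrable. *)

(* Defs.v *)
(* MathComp-Analysis, over an arbitrary [R : realType]; complex numbers [R[i]]
   come from mathcomp-real-closed. *)
From HB Require Import structures.
From mathcomp Require Export all_boot all_order all_algebra.
From mathcomp Require Export all_classical all_reals all_analysis.
From mathcomp Require Export complex.

Set Implicit Arguments.
Unset Strict Implicit.
Unset Printing Implicit Defensive.

Export Order.TTheory GRing.Theory Num.Theory.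
Export numFieldNormedType.Exports.

Global Open Scope classical_set_scope.
Global Open Scope ring_scope.

Section special_functions.
Variable R : realType.

(* Euler's integral, hence meaningful for [0 < x] only. *)
Definition Gamma (x : R) : R :=
  \int[lebesgue_measure]_(t in `]0, +oo[) (t `^ (x - 1) * expR (- t)).

(* [mittag_leffler b c x] is $E_{b,c}(x)$, for [0 < b], [0 < c]. *)
Definition mittag_leffler (b c x : R) : R :=
  limn (pseries (fun j : nat => (Gamma (b * j%:R + c))^-1) x).

End special_functions.

Section processes.
Context d (T : measurableType d) (R : realType) (P : probability T R).

(* The degenerate law is treated apart, because [normal_prob m 0] is not
   [\d_m]; [s] is the standard deviation. Laws are compared on Borel sets only,
   since measures are unspecified on the other sets. *)
Definition gaussian_law (X : T -> R) : Prop :=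
  (exists m : R, forall A : set R, measurable A ->
     pushforward P X A = \d_m A) \/
  (exists m s : R, 0 < s /\ forall A : set R, measurable A ->
     pushforward P X A = normal_prob m s A).

Variable Y : {nonneg R} -> {RV P >-> R}.

Definition gaussian_process : Prop :=
  forall (n : nat) (t : n.-tuple {nonneg R}) (a : n.-tuple R),
    gaussian_law (fun x => \sum_(i < n) tnth a i * Y (tnth t i) x).

Definition centered_process : Prop :=
  forall t : {nonneg R}, ('E_P[Y t] = 0)%E.

Definition process_at (n : nat) (t : n.-tuple {nonneg R}) (x : T) : n.-tuple R :=
  [tuple Y (tnth t i) x | i < n].

Definition stationary_process : Prop :=
  forall (n : nat) (t : n.-tuple {nonneg R}) (h : {nonneg R})
      (B : set (n.-tuple R)), measurable B ->
    P (process_at [tuple ((tnth t i)%:num + h%:num)%:nng | i < n] @^-1` B) =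
    P (process_at t @^-1` B).

(* Covariance function of a stationary process indexed by [0, +oo[, at an
   arbitrary real lag: it is even, so a lag [s < 0] is read off at [- s]. *)
Definition autocovariance (s : R) : R :=
  fine (covariance P (Y 0%:nng) (Y `|s|%:nng)).

End processes.

Section spectral_density.
Variable R : realType.

Definition expi (x : R) : R[i] := (cos x +i* sin x)%C.

(* The two endpoints tend to -oo and +oo independently of each other. *)
Definition improper_integral (f : R -> R) : R :=
  lim ((fun ab : R * R => \int[lebesgue_measure]_(s in `[ab.1, ab.2]) f s)
         @ filter_prod -oo +oo).

Definition improper_integrable (f : R -> R) : Prop :=
  (forall a b : R,
     lebesgue_measure.-integrable `[a, b] (fun s => (f s)%:E)) /\
  cvg ((fun ab : R * R => \int[lebesgue_measure]_(s in `[ab.1, ab.2]) f s)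
         @ filter_prod -oo +oo).

Definition cimproper_integral (f : R -> R[i]) : R[i] :=
  (improper_integral (fun s => complex.Re (f s)) +i*
   improper_integral (fun s => complex.Im (f s)))%C.

Definition cimproper_integrable (f : R -> R[i]) : Prop :=
  improper_integrable (fun s => complex.Re (f s)) /\
  improper_integrable (fun s => complex.Im (f s)).

Definition fourier_integrand (r : R -> R) (w s : R) : R[i] :=
  expi (- (w * s)) * (r s)%:C%C.

End spectral_density.

Section process_spectral_density.
Context d (T : measurableType d) (R : realType) (P : probability T R).
Variable Y : {nonneg R} -> {RV P >-> R}.

(* At a frequency where the integral does not converge, [spectral_density] is
   unspecified: see [has_spectral_density]. *)
Definition spectral_density (w : R) : R[i] :=
  ((2 * pi)^-1)%:C%C *
  cimproper_integral (fourier_integrand (autocovariance Y) w).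

Definition has_spectral_density : Prop :=
  forall w : R, w != 0 ->
    cimproper_integrable (fourier_integrand (autocovariance Y) w).

End process_spectral_density.

(* Main.v *)
Require Import Defs.
From mathcomp Require Import measurable_realfun.
From mathcomp Require Import ring lra.

Set Implicit Arguments.
Unset Strict Implicit.
Unset Printing Implicit Defensive.

(* Write [f t] for $E_{\alpha,1}(-\gamma t^\alpha)$. Termwise integration of the
   power series, with Euler's Beta integral, gives the Abel equation
     \int_0^t (t - s)^{-\alpha} f(s) ds
       = t^{1-\alpha} / (1-\alpha) - \gamma \Gamma(1-\alpha) \int_0^t f,
   and everything else is read off from it. A minimum principle for Abel
   integrals, applied to [f], to [1 - f] and to [s |-> f s - f (s + d)], shows
   that [0 <= f <= 1] and that [f] is nonincreasing. As the left-hand side is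
   nonnegative, \int_0^t f <= A t^{1-\alpha}, hence f(t) <= A t^{-\alpha}; this in
   turn makes the left-hand side negligible, so \int_0^t f ~ A t^{1-\alpha}, and
   monotonicity yields the asymptotics of [f]. Finally, [f] being nonincreasing,
   the oscillating integral over [T, +oo[ at frequency [w] is at most 2 f(T) / |w|,
   and one takes T = 1 / |w|. *)

(** In differentiated form the equation says that the Caputo derivative of order alpha of f is
    -gamma f, but f' blows up like t^(alpha-1) at 0. The integrated form avoids f': the minimum
    principle only compares increments of Abel integrals up to a positive time, where f is
    differentiable. Extending f by 1 to the negative half-line is what makes the shift argument
    work. With a history starting at -d, the Abel integrals of f and of f(. + d) have the same
    forcing term (t + d)^(1-alpha) / (1-alpha), which cancels in the difference and leaves a
    homogeneous equation. The constant A is 1 / ((1-alpha) gamma Gamma(1-alpha)), so f(t) ~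
    t^(-alpha) / (gamma Gamma(1-alpha)). Since \int_0^t f grows like t^(1-alpha), f is not
    integrable at infinity: monotonicity and oscillation must supply even the convergence of the
    Fourier integral. The cut T = 1 / |w| balances its two parts: [0, T] costs A T^(1-alpha) and the
    tail a multiple of T^(-alpha) / |w|, both of order |w|^(alpha-1). *)

Section affine.
Context {R : realType}.
Local Notation mu := (@lebesgue_measure R).

Lemma preimage_affine_itvoc (c d a b : R) : c != 0 ->
  (fun y : R => c * y + d) @^-1` `]a, b]%classic =
  if 0 < c then `](a - d) / c, (b - d) / c]%classic
  else `[(b - d) / c, (a - d) / c[%classic.
Proof.
move=> c0; apply/seteqP; case: ltgtP c0 => // c0 _.
- by split=> y /=; rewrite !in_itv/= ltr_pdivrMr// ler_pdivlMr// ltrBlDr lerBrDr mulrC.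
- by split=> y /=; rewrite !in_itv/= ler_ndivrMr// ltr_ndivlMr// ltrBlDr lerBrDr mulrC andbC.
Qed.

(** The pushforward of Lebesgue measure under the affine map, scaled by |c|, has the right value on
    the intervals ]a, b], hence is Lebesgue measure by uniqueness. *)
Lemma ge0_integral_affine (f : R -> \bar R) (c d : R) : c != 0 ->
  measurable_fun [set: R] f -> (forall x, 0 <= f x)%E ->
  (\int[mu]_y f (c * y + d)%R = (`|c|^-1)%:E * \int[mu]_y f y)%E.
Proof.
move=> c0 mf f0.
have mphi : measurable_fun [set: measurableTypeR R]
    (fun y : measurableTypeR R => (c * y + d : measurableTypeR R)).
  by apply: measurable_funD => //; exact: measurable_funM.
have nc : 0 < `|c| by rewrite normr_gt0.
have nnc : 0 <= `|c|^-1 by rewrite invr_ge0 ltW.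
transitivity (\int[mscale (NngNum nnc) mu]_y f y)%E; last first.
  by rewrite ge0_integral_mscale.
rewrite -[LHS](ge0_integral_pushforward mphi mu measurableT mf) //=.
apply: eq_measure_integral => A mA _.
pose m : {measure set (measurableTypeR R) -> \bar R} :=
  measure_function_pushforward__canonical__measure_function_Measure mu mphi.
have E : forall X, measurable X -> mu X = mscale (NngNum (ltW nc)) m X.
  apply: lebesgue_measure_unique => _ [[a b]] _ <-.
  rewrite /mscale/= /m/= /pushforward.
  rewrite [X in _ = (_ * lebesgue_measure X)%E](preimage_affine_itvoc d a b c0)//.
  case: ifPn => c1; rewrite !lebesgue_measure_itv/= !lte_fin.
    rewrite (gtr0_norm c1) ltr_pM2r ?invr_gt0// ltrBlDr subrK.
    by case: ifPn => // ab; rewrite ?mule0// -!EFinB -EFinM; congr EFin; field.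
  have {c1}c1 : c < 0 by rewrite lt_neqAle c0 leNgt.
  rewrite (ltr0_norm c1) ltr_nM2r ?invr_lt0// ltrBlDr subrK.
  by case: ifPn => // ab; rewrite ?mule0// -!EFinB -EFinM; congr EFin; field.
rewrite [RHS](_ : _ = (`|c|^-1)%:E * mu A)%E// E// /mscale/= muleA -EFinM mulVf ?mul1e//.
exact: lt0r_neq0.
Qed.
End affine.

(** * Euler integrals *)

Lemma is_derive1_cvg {R : realType} (f : R -> R) (x df : R) :
  is_derive x 1 f df -> f y @[y --> x] --> f x.
Proof.
by case=> dfx _; have /derivable1_diffP/differentiable_continuous := dfx.
Qed.

Section ppow.
Context {R : realType}.
Implicit Types a b s t v x y : R.
Local Notation mu := (@lebesgue_measure R).

(* [powR] is 1 on the negative half-line, [ppow] is 0 there: convolutions over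
   [0, t] become integrals over the whole line. *)
Definition ppow a s : R := if 0 < s then s `^ a else 0.

Lemma ppow_powR a s : 0 < s -> ppow a s = s `^ a.
Proof. by rewrite /ppow => ->. Qed.

Lemma ppow_le0 a s : s <= 0 -> ppow a s = 0.
Proof. by rewrite /ppow leNgt => /negbTE ->. Qed.

Lemma ppow_ge0 a s : 0 <= ppow a s.
Proof. by rewrite /ppow; case: ifP => // _; exact: powR_ge0. Qed.

Lemma ppowD a b s : ppow (a + b) s = ppow a s * ppow b s.
Proof.
have [s0|s0] := ltP 0 s; last by rewrite !ppow_le0// mul0r.
by rewrite !ppow_powR// powRD// (gt_eqF s0) implybT.
Qed.

Lemma ppowM a t s : 0 < t -> ppow a (t * s) = t `^ a * ppow a s.
Proof.
move=> t0; have [s0|s0] := ltP 0 s.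
  by rewrite !ppow_powR// ?mulr_gt0// powRM// ltW.
by rewrite !ppow_le0// ?mulr0// pmulr_rle0.
Qed.

Lemma measurable_ppow a : measurable_fun [set: R] (ppow a).
Proof.
apply: measurable_fun_ifT.
- exact: measurable_fun_ltr.
- exact: measurable_powR.
- exact: measurable_cst.
Qed.

Definition gamma_density x v : R := ppow (x - 1) v * expR (- v).
Definition beta_density x y v : R := ppow (x - 1) v * ppow (y - 1) (1 - v).

(** Extended-real values let Tonelli's theorem apply for all parameters; finiteness is deduced
    afterwards from the identities so obtained. *)
Definition eGamma x := (\int[mu]_v (gamma_density x v)%:E)%E.
Definition ebeta x y := (\int[mu]_v (beta_density x y v)%:E)%E.

Lemma gamma_density_ge0 x v : 0 <= gamma_density x v.
Proof. by rewrite mulr_ge0// ?ppow_ge0// expR_ge0. Qed.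

Lemma beta_density_ge0 x y v : 0 <= beta_density x y v.
Proof. by rewrite mulr_ge0// ppow_ge0. Qed.

Lemma measurable_gamma_density x : measurable_fun [set: R] (gamma_density x).
Proof.
apply: measurable_funM; first exact: measurable_ppow.
by apply: measurableT_comp => //; exact: measurableT_comp.
Qed.

Lemma measurable_beta_density x y : measurable_fun [set: R] (beta_density x y).
Proof.
apply: measurable_funM; first exact: measurable_ppow.
apply: (measurableT_comp (measurable_ppow _)).
exact: measurable_funB.
Qed.

(** Substitute s = t v and use homogeneity. Both sides may be infinite, so no sign condition on [x],
    [y] is required; for t <= 0 the two factors have disjoint supports. *)
Lemma ppow_convolution x y t :
  (\int[mu]_s (ppow (x - 1) s * ppow (y - 1) (t - s))%:E =
   (ppow (x + y - 1) t)%:E * ebeta x y)%E.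
Proof.
have [t0|t0] := ltP 0 t; last first.
  rewrite (ppow_le0 _ t0) mul0e integral0_eq// => s _.
  have [s0|s0] := ltP 0 s; last by rewrite (ppow_le0 _ s0) mul0r.
  by rewrite (ppow_le0 (y - 1)) ?mulr0// subr_le0 (le_trans t0)// ltW.
transitivity (\int[mu]_s ((t `^ (x - 1) * t `^ (y - 1))%:E * (beta_density x y (t^-1 * s + 0))%:E))%E.
  apply: eq_integral => s _; rewrite -EFinM; congr EFin.
  rewrite /beta_density addr0.
  have -> : t - s = t * (1 - t^-1 * s) by field; rewrite gt_eqF.
  have {1}-> : s = t * (t^-1 * s) by field; rewrite gt_eqF.
  by rewrite !(ppowM _ _ t0); ring.
rewrite ge0_integralZl_EFin//; first last.
- by rewrite mulr_ge0// powR_ge0.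
- apply/measurable_EFinP; apply: (measurableT_comp (measurable_beta_density x y)).
  by apply: measurable_funD => //; exact: measurable_funM.
- by move=> s _; rewrite lee_fin beta_density_ge0.
rewrite (@ge0_integral_affine _ (EFin \o beta_density x y) t^-1 0)//=; first last.
- by move=> v; rewrite lee_fin beta_density_ge0.
- by apply/measurable_EFinP; exact: measurable_beta_density.
- by rewrite invr_eq0 gt_eqF.
rewrite muleA -EFinM; congr (_%:E * _)%E.
rewrite gtr0_norm ?invr_gt0// invrK ppow_powR//.
rewrite -{3}(powRr1 (ltW t0)) -!powRD ?(gt_eqF t0) ?implybT//.
by congr (_ `^ _); ring.
Qed.

Lemma eGammaM x y : (eGamma x * eGamma y = ebeta x y * eGamma (x + y))%E.
Proof.
rewrite /eGamma.
have mg z : measurable_fun [set: R] (EFin \o gamma_density z).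
  by apply/measurable_EFinP; exact: measurable_gamma_density.
have eG0 z : (0 <= \int[mu]_v (gamma_density z v)%:E)%E.
  by apply: integral_ge0 => v _; rewrite lee_fin gamma_density_ge0.
(* The second variable is translated by the first: after exchanging the integrals the exponentials
   merge into exp(-v), and the inner integral is a convolution of powers. *)
pose h (p : R * R) := (gamma_density x p.1 * gamma_density y (p.2 - p.1))%:E.
transitivity (\int[mu]_u \int[mu]_v h (u, v))%E.
  rewrite -ge0_integralZr//; [|exact: mg|by move=> u _; rewrite lee_fin gamma_density_ge0].
  apply: eq_integral => u _; rewrite /h/=.
  rewrite -(_ : \int[mu]_v (gamma_density y (1 * v + - u))%:E =
               \int[mu]_v (gamma_density y v)%:E)%E; last first.
    rewrite (@ge0_integral_affine _ (EFin \o gamma_density y))// ?oner_eq0//.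
      by rewrite normr1 invr1 mul1e.
    by move=> v; rewrite lee_fin gamma_density_ge0.
  rewrite -ge0_integralZl//.
  - by apply: eq_integral => v _; rewrite mul1r -EFinM.
  - apply/measurable_EFinP; apply: (measurableT_comp (measurable_gamma_density y)).
    by apply: measurable_funD => //; exact: measurable_funM.
  - by move=> v _; rewrite lee_fin gamma_density_ge0.
  - by rewrite lee_fin gamma_density_ge0.
transitivity (\int[mu]_v \int[mu]_u h (u, v))%E.
  apply: fubini_tonelli; last by move=> p; rewrite /h lee_fin mulr_ge0// gamma_density_ge0.
  apply/measurable_EFinP; apply: measurable_funM.
    by apply: (measurableT_comp (measurable_gamma_density x)).
  apply: (measurableT_comp (measurable_gamma_density y)).
  by apply: measurable_funB.
rewrite -ge0_integralZl//.
- apply: eq_integral => v _.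
  transitivity (\int[mu]_u ((expR (- v))%:E * (ppow (x - 1) u * ppow (y - 1) (v - u))%:E))%E.
    apply: eq_integral => u _; rewrite /h/= -EFinM; congr EFin.
    rewrite /gamma_density.
    have -> : expR (- v) = expR (- u) * expR (- (v - u)) by rewrite -expRD; congr expR; ring.
    ring.
  rewrite ge0_integralZl_EFin ?expR_ge0//; first last.
  + apply/measurable_EFinP; apply: measurable_funM; first exact: measurable_ppow.
    by apply: (measurableT_comp (measurable_ppow _)); exact: measurable_funB.
  + by move=> s _; rewrite lee_fin mulr_ge0// ppow_ge0.
  rewrite ppow_convolution muleA -EFinM muleC; congr (_ * _)%E.
  by rewrite /gamma_density mulrC.
- exact: mg.
- by move=> v _; rewrite lee_fin gamma_density_ge0.
- by apply: integral_ge0 => v _; rewrite lee_fin beta_density_ge0.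
Qed.

(** This is the total mass of the exponential law of rate 1. *)
Lemma eGamma1 : eGamma 1 = 1%E.
Proof.
rewrite -(@integral_exponential_pdf R 1 ltr01).
transitivity (\int[mu]_(v in `[0%R, +oo[) (expR (- v))%:E)%E; last first.
  rewrite integral_mkcond; apply: eq_integral => v _.
  by rewrite /exponential_pdf !patchE mul1r mulN1r; case: ifPn.
rewrite -integral_itv_obnd_cbnd; last first.
  apply: measurable_funTS; apply/measurable_EFinP.
  by apply: measurableT_comp => //; exact: measurableT_comp.
rewrite integral_mkcond; apply: eq_integral => v _.
rewrite patchE/= /gamma_density subrr; case: ifPn.
  by rewrite inE/= in_itv/= andbT => v0; rewrite ppow_powR// powRr0 mul1r.
move=> v0; rewrite ppow_le0 ?mul0r// leNgt; apply: contra v0 => v0.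
by rewrite inE/= in_itv/= andbT.
Qed.

(** The cutoff [e] keeps away from 0, where the integrand is singular if x < 1, so that the
    fundamental theorem of calculus applies. *)
Lemma integral_powR_itv (x e : R) : 0 < x -> 0 < e < 1 ->
  (\int[mu]_(v in `[e, 1%R]) (ppow (x - 1) v)%:E = (x^-1 * (1 - e `^ x))%R%:E)%E.
Proof.
move=> x0 /andP[e0 e1].
have gt0 v : v \in `[e, 1] -> 0 < v.
  by rewrite in_itv/= => /andP[+ _]; exact: lt_le_trans.
have dF (v : R) : 0 < v -> is_derive v 1 (fun v : R => x^-1 * v `^ x) (v `^ (x - 1)).
  move=> v0.
  have h := is_derive1_powR x v0.
  apply: is_derive_eq; rewrite /GRing.scale/= mulrA mulVf ?mul1r// gt_eqF//.
transitivity (\int[mu]_(v in `[e, 1%R]) (v `^ (x - 1))%:E)%E.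
  by apply: eq_integral => v; rewrite inE => /gt0 v0; rewrite ppow_powR.
rewrite (@continuous_FTC2 _ _ (fun v => x^-1 * v `^ x)) //.
- by rewrite -EFinB powR1; congr EFin; ring.
- apply: derivable_within_continuous => v /gt0 v0; by case: (is_derive1_powR (x - 1) v0).
- split.
  + by move=> v /subset_itv_oo_cc /gt0 /dF; case.
  + apply: cvg_at_right_filter; exact: is_derive1_cvg (dF e e0).
  + apply: cvg_at_left_filter; exact: is_derive1_cvg (dF 1 ltr01).
- move=> v /subset_itv_oo_cc /gt0 /dF h; rewrite derive1E; exact: derive_val.
Qed.

Lemma ebeta1 x : 0 < x -> ebeta x 1 = (x^-1)%:E.
Proof.
move=> x0; rewrite /ebeta.
(* Monotone convergence along the cutoffs 1/(n+2); the shift by 2 keeps them strictly below 1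
   already at n = 0. *)
pose g n v := (ppow (x - 1) v * \1_(`[n.+2%:R^-1, 1]) v)%:E : \bar R.
have mg n : measurable_fun [set: R] (g n).
  by apply/measurable_EFinP; apply: measurable_funM; [exact: measurable_ppow|exact: measurable_indic].
have g0 n v : setT v -> (0 <= g n v)%E by rewrite lee_fin mulr_ge0 ?ppow_ge0.
have ndg v : setT v -> {homo g^~ v : n m / (n <= m)%N >-> (n <= m)%E}.
  move=> _ n m nm; rewrite lee_fin ler_wpM2l ?ppow_ge0// !indicE ler_nat.
  have [vn|] := boolP (v \in `[n.+2%:R^-1, 1]%classic); last by [].
  rewrite mem_set//; move: vn; rewrite inE/= !in_itv/= => /andP[+ ->]; rewrite andbT.
  by apply: le_trans; rewrite lef_pV2 ?posrE// ler_nat ltnS.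
have cvgg := @cvg_monotone_convergence _ _ _ mu _ measurableT _ mg g0 ndg.
have n2 n : 0 < (n.+2%:R^-1 : R) < 1 by rewrite invr_gt0 ltr0n/= invf_lt1 ?ltr0n// ltr1n.
have intg n : (\int[mu]_v g n v = (x^-1 * (1 - (n.+2%:R^-1) `^ x))%:E)%E.
  rewrite -integral_powR_itv// [RHS]integral_mkcond; apply: eq_integral => v _.
  by rewrite /g patchE indicE; case: ifPn => _; rewrite ?mulr1 ?mulr0.
have lim1 : (\int[mu]_v g n v)%E @[n --> \oo] --> (x^-1)%:E.
  under eq_fun do rewrite intg.
  apply: cvg_EFin; first by apply: nearW.
  rewrite -[X in _ --> X]mulr1; apply: cvgMr.
  rewrite -[X in _ --> X]subr0; apply: cvgB; first exact: cvg_cst.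
  have /cvg_at_rightP := powR_cvg0 x0; apply; split.
    by move=> n; case/andP: (n2 n).
  by rewrite (cvg_shiftS (fun n => n.+1%:R^-1 : R)); exact: cvg_harmonic.
transitivity (\int[mu]_v (fun v => limn (g^~ v)) v)%E; last exact: (cvg_unique _ cvgg lim1).
transitivity (\int[mu]_v (ppow (x - 1) v * \1_(`]0%R, 1%R]%classic : set R) v)%R%:E)%E; last first.
  apply: eq_integral => v _; apply/esym/cvg_lim => //.
  have [v01|v01] := boolP (v \in `]0, 1]%classic); last first.
    rewrite indicE (negbTE v01) mulr0.
    apply: cvg_near_cst; apply: nearW => n; rewrite /g indicE.
    rewrite (negbTE (_ : v \notin _)) ?mulr0//; apply: contra v01.
    rewrite !inE/= !in_itv/= => /andP[+ ->]; rewrite andbT; apply: lt_le_trans.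
    by case/andP: (n2 n).
  rewrite indicE v01 mulr1.
  have /andP[v0 v1] : 0 < v <= 1 by move: v01; rewrite inE/= in_itv.
  apply: cvg_near_cst; near=> n; rewrite /g indicE mem_set ?mulr1//=.
  rewrite in_itv/= v1 andbT.
  apply: (@le_trans _ _ n.+1%:R^-1); first by rewrite lef_pV2 ?posrE// ler_nat.
  by apply: ltW; near: n; apply: (near_infty_natSinv_lt (PosNum v0)).
transitivity (\int[mu]_(v in `]0%R, 1%R[) (ppow (x - 1) v)%:E)%E.
  rewrite [RHS]integral_mkcond; apply: eq_integral => v _.
  rewrite patchE/= /beta_density subrr; case: ifPn.
    rewrite inE/= in_itv/= => /andP[v0 v1].
    by rewrite [ppow 0 _]ppow_powR ?subr_gt0// powRr0 mulr1.
  rewrite notin_setE/= in_itv/= => /negP; rewrite negb_and -!leNgt => /orP[v0|v1].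
    by rewrite (ppow_le0 (x - 1))// mul0r.
  by rewrite [ppow 0 _]ppow_le0 ?mulr0// subr_le0.
rewrite integral_itv_bndo_bndc; last first.
  by apply: measurable_funTS; apply/measurable_EFinP; exact: measurable_ppow.
rewrite integral_mkcond; apply: eq_integral => v _.
by rewrite patchE indicE; case: ifPn => _; rewrite ?mulr1 ?mulr0.
Unshelve. all: by end_near. Qed.

(** The case y = 1 of the product formula, in place of an integration by parts. *)
Lemma eGammaS x : 0 < x -> eGamma (x + 1) = (x%:E * eGamma x)%E.
Proof.
move=> x0; have := eGammaM x 1; rewrite eGamma1 mule1 ebeta1// => ->.
by rewrite muleA -EFinM mulfV ?mul1e// gt_eqF.
Qed.

Lemma eGamma_ge0 x : (0 <= eGamma x)%E.
Proof. by apply: integral_ge0 => v _; rewrite lee_fin gamma_density_ge0. Qed.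

Lemma eGamma_lty x : 0 < x -> (eGamma x < +oo)%E.
Proof.
move=> x0; have [n] : exists n : nat, x <= n.+1%:R.
  exists (Num.truncn x); rewrite ltW//; exact: truncnS_gt.
elim: n x x0 => [|n IH] x x0 xn; last first.
  have [x1|x1] := ltP 1 x; last by apply: IH => //; rewrite (le_trans x1)// ler1n.
  rewrite -(subrK 1 x) eGammaS ?subr_gt0//.
  rewrite lte_mul_pinfty ?lee_fin ?subr_ge0 1?ltW//; apply: IH; first by rewrite subr_gt0.
  by rewrite lerBlDr natr1.
(* Base case 0 < x <= 1: the density is at most v^(x-1) on ]0, 1[ and at most exp(-v) from 1 on. *)
apply: (@le_lt_trans _ _ (ebeta x 1 + eGamma 1)%E); last first.
  by rewrite ebeta1// eGamma1 -EFinD ltry.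
rewrite -ge0_integralD//; first last.
- by apply/measurable_EFinP; exact: measurable_gamma_density.
- by move=> v _; rewrite lee_fin gamma_density_ge0.
- by apply/measurable_EFinP; exact: measurable_beta_density.
- by move=> v _; rewrite lee_fin beta_density_ge0.
apply: ge0_le_integral => //.
- by move=> v _; rewrite lee_fin gamma_density_ge0.
- by apply/measurable_EFinP; exact: measurable_gamma_density.
- apply: emeasurable_funD.
  + by apply/measurable_EFinP; exact: measurable_beta_density.
  + by apply/measurable_EFinP; exact: measurable_gamma_density.
move=> v _; rewrite -EFinD lee_fin.
have [v0|v0] := ltP 0 v; last first.
  by rewrite /gamma_density ppow_le0// mul0r addr_ge0 ?gamma_density_ge0 ?beta_density_ge0.
have [v1|v1] := ltP v 1.
  rewrite ler_wpDr ?gamma_density_ge0// ler_wpM2l ?ppow_ge0//.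
  rewrite subrr ppow_powR ?subr_gt0// powRr0 -expR0 ler_expR; lra.
rewrite ler_wpDl ?beta_density_ge0// ler_wpM2r ?expR_ge0// subrr !ppow_powR// powRr0.
by rewrite -[leRHS](powRr0 v) ler_powR// subr_le0.
Qed.

(** Keep only the integral over ]M, 2M]. As [M] is arbitrary, Gamma outgrows every geometric
    sequence, which is what makes the Mittag-Leffler series entire. *)
Lemma eGamma_lower_bound (M x : R) : 0 < M -> 1 <= x ->
  ((M `^ x * expR (- (2 * M)))%:E <= eGamma x)%E.
Proof.
move=> M0 x1.
apply: (@le_trans _ _ (\int[mu]_(v in `]M, (2 * M)%R]) (M `^ (x - 1) * expR (- (2 * M)))%:E)%E).
  rewrite integral_cst//= lebesgue_measure_itv/= lte_fin ifT; last lra.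
  rewrite -EFinB -EFinM lee_fin (_ : _ - M = M `^ 1); last by rewrite powRr1 ?ltW//; ring.
  rewrite mulrAC -powRD; last by rewrite (gt_eqF M0) implybT.
  by rewrite subrK.
apply: (@le_trans _ _ (\int[mu]_(v in `]M, (2 * M)%R]) (gamma_density x v)%:E)%E).
  apply: ge0_le_integral => //=.
  - by move=> v _; rewrite lee_fin mulr_ge0 ?powR_ge0 ?expR_ge0.
  - by apply: measurable_funTS; apply/measurable_EFinP; exact: measurable_gamma_density.
  move=> v; rewrite in_itv/= => /andP[Mv vM]; rewrite lee_fin.
  rewrite /gamma_density ppow_powR ?(lt_trans M0)//.
  rewrite ler_pM ?powR_ge0 ?expR_ge0 ?ler_expR ?lerN2//.
  by rewrite ge0_ler_powR ?subr_ge0// ?nnegrE ltW// (lt_trans M0).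
apply: ge0_subset_integral => //.
  by apply/measurable_EFinP; exact: measurable_gamma_density.
by move=> v _; rewrite lee_fin gamma_density_ge0.
Qed.

Lemma GammaE x : Gamma x = fine (eGamma x).
Proof.
rewrite /Gamma /Rintegral; congr fine; rewrite integral_mkcond.
apply: eq_integral => v _; rewrite patchE /gamma_density; case: ifPn.
  by rewrite inE/= in_itv/= andbT => v0; rewrite ppow_powR.
rewrite notin_setE/= in_itv/= andbT => /negP; rewrite -leNgt => v0.
by rewrite ppow_le0// mul0r.
Qed.

Lemma EFin_Gamma x : 0 < x -> (Gamma x)%:E = eGamma x.
Proof.
by move=> x0; rewrite GammaE fineK// ge0_fin_numE ?eGamma_lty ?eGamma_ge0.
Qed.

Lemma GammaS x : 0 < x -> Gamma (x + 1) = x * Gamma x.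
Proof.
move=> x0; apply: EFin_inj; rewrite EFinM !EFin_Gamma ?eGammaS//.
exact: addr_gt0.
Qed.

Lemma Gamma_lower_bound (M x : R) : 0 < M -> 1 <= x ->
  M `^ x * expR (- (2 * M)) <= Gamma x.
Proof.
move=> M0 x1; rewrite -lee_fin EFin_Gamma ?eGamma_lower_bound//.
exact: lt_le_trans x1.
Qed.

Lemma Gamma_gt0 x : 0 < x -> 0 < Gamma x.
Proof.
move=> x0; rewrite -(pmulr_rgt0 _ x0) -GammaS//.
apply: lt_le_trans (Gamma_lower_bound ltr01 _); last by rewrite lerDr ltW.
by rewrite powR1 mul1r expR_gt0.
Qed.

Lemma Gamma1 : Gamma (1 : R) = 1.
Proof. by apply: EFin_inj; rewrite EFin_Gamma// eGamma1. Qed.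

Lemma ebetaE x y : 0 < x -> 0 < y ->
  ebeta x y = (Gamma x * Gamma y / Gamma (x + y))%:E.
Proof.
move=> x0 y0; have := eGammaM x y.
rewrite -!EFin_Gamma ?addr_gt0// -EFinM.
have G0 := Gamma_gt0 (addr_gt0 x0 y0).
have b0 : (0 <= ebeta x y)%E by apply: integral_ge0 => v _; rewrite lee_fin beta_density_ge0.
case: (ebeta x y) b0 => [b _|_|//].
  by rewrite -EFinM => -[->]; rewrite mulfK// gt_eqF.
(* An infinite Beta integral would make the finite product of Gamma values infinite. *)
by rewrite gt0_mulye.
Qed.

End ppow.

(** * Mittag-Leffler functions *)

Section entire.
Context {R : realType}.
Implicit Types (c : nat -> R) (x B : R).

(** Infinite radius of convergence, encoded as boundedness of the terms at every radius: this is
    what a lower bound on Gamma yields directly, and enlarging [B] recovers summability. *)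
Definition entire c := forall B, 0 < B -> exists K, forall j, `|c j| * B ^+ j <= K.

Lemma entire_diffs c : entire c -> entire (pseries_diffs c).
Proof.
(* The doubled radius absorbs the factor j + 1 of the derived series into 2^(j+1). *)
move=> ec B B0; have [K HK] := ec _ (mulr_gt0 (ltr0Sn R 1) B0).
have K0 : 0 <= K by apply: le_trans (HK 0%N); rewrite mulr1.
exists (K / B) => j; rewrite ler_pdivlMr//.
apply: le_trans (HK j.+1); rewrite /pseries_diffs normrM normr_nat exprMn.
rewrite [leLHS](_ : _ = j.+1%:R * (`|c j.+1| * B ^+ j.+1)); last by rewrite exprS; ring.
rewrite [leRHS]mulrCA ler_wpM2r//; first by rewrite mulr_ge0// exprn_ge0// ltW.
by rewrite -natrX ler_nat ltnW// ltn_expl.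
Qed.

(* Taking [B = 2 (X + 1)] makes the general term at most [K 2^-j] on the disc of radius [X]. *)
Lemma entire_geometric c (X : R) : 0 <= X -> entire c ->
  exists2 K, 0 <= K & forall x j, `|x| <= X -> `|c j * x ^+ j| <= geometric K (1 / 2) j.
Proof.
move=> X0 ec; have B0 : 0 < 2 * (X + 1) by lra.
have [K HK] := ec _ B0; exists K => [|x j xX].
  by apply: le_trans (HK 0%N); rewrite mulr1.
rewrite /geometric/= normrM normrX.
apply: (@le_trans _ _ (`|c j| * (2 * (X + 1)) ^+ j * (1 / 2) ^+ j)); last first.
  by rewrite ler_wpM2r// exprn_ge0.
rewrite -mulrA -exprMn ler_wpM2l// lerXn2r ?nnegrE//; lra.
Qed.

(** Uniformity in both the argument and the number of terms provides the dominating constant when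
    partial sums are integrated. *)
Lemma entire_bounded c (X : R) : 0 <= X -> entire c ->
  exists M, forall x n, `|x| <= X -> `|pseries c x n| <= M.
Proof.
move=> X0 ec; have [K K0 HK] := entire_geometric X0 ec.
exists (K / (1 - 1 / 2)) => x n xX; rewrite /pseries /series/=.
apply: le_trans (ler_norm_sum _ _ _) _.
apply: (@le_trans _ _ (series (geometric K (1 / 2)) n)).
  by apply: ler_sum => j _; exact: HK.
rewrite geometric_seriesE/=; last lra.
rewrite [leLHS]mulrAC -[leRHS]mulr1 ler_wpM2l//; by rewrite ?gerBl ?exprn_ge0// divr_ge0//; lra.
Qed.

Lemma is_cvg_entire c x : entire c -> cvgn (pseries c x).
Proof.
move=> ec; have [K K0 HK] := entire_geometric (normr_ge0 x) ec.
apply: normed_cvg; apply: (@series_le_cvg _ _ (geometric K (1 / 2))) => [j|j|j|].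
- exact: normr_ge0.
- by rewrite /geometric/= mulr_ge0// exprn_ge0.
- exact: HK.
- by apply: is_cvg_geometric_series; rewrite ger0_norm; lra.
Qed.

Lemma is_derive_entire c x : entire c ->
  is_derive x 1 (fun x => limn (pseries c x)) (limn (pseries (pseries_diffs c) x)).
Proof.
move=> ec; apply: (@pseries_snd_diffs _ c (`|x| + 1)).
- exact: is_cvg_entire.
- exact/is_cvg_entire/entire_diffs.
- exact/is_cvg_entire/entire_diffs/entire_diffs.
- by rewrite [ltRHS]ger0_norm ?ltrDl// addr_ge0.
Qed.

End entire.

Section mittag_leffler_fun.
Context {R : realType}.
Variables (a g : R).
Hypotheses (a0 : 0 < a) (g0 : 0 < g).
Implicit Types s t : R.
Local Notation mu := (@lebesgue_measure R).

Definition ml_coef (j : nat) : R := (Gamma (a * j%:R + 1))^-1.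

Lemma ml_coef_arg_gt0 j : 0 < a * j%:R + 1.
Proof. by rewrite ltr_wpDl// mulr_ge0// ltW. Qed.

Lemma ml_coef_ge0 j : 0 <= ml_coef j.
Proof. by rewrite invr_ge0 ltW// Gamma_gt0// ml_coef_arg_gt0. Qed.

Lemma entire_ml_coef : entire ml_coef.
Proof.
(* With M^a = B the lower bound on Gamma(a j + 1) becomes B^j M exp(-2M), whose only dependence on j
   is the factor to be cancelled. *)
move=> B B0; pose M := B `^ a^-1; have M0 : 0 < M by rewrite powR_gt0.
exists (M^-1 * expR (2 * M)) => j; rewrite ger0_norm ?ml_coef_ge0//.
have h : M `^ (a * j%:R + 1) * expR (- (2 * M)) <= Gamma (a * j%:R + 1).
  by apply: Gamma_lower_bound => //; rewrite lerDr mulr_ge0// ltW.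
rewrite mulrC ler_pdivrMr ?Gamma_gt0 ?ml_coef_arg_gt0//.
apply: (@le_trans _ _ (M^-1 * expR (2 * M) * (M `^ (a * j%:R + 1) * expR (- (2 * M))))); last first.
  by rewrite ler_wpM2l// mulr_ge0 ?expR_ge0// invr_ge0 ltW.
have Ma : M `^ a = B.
  by rewrite /M -powRrM mulVf ?powRr1 ?(ltW B0)// gt_eqF.
have -> : M `^ (a * j%:R + 1) = B ^+ j * M.
  rewrite powRD; last by rewrite (gt_eqF M0) implybT.
  by rewrite powRr1 ?(ltW M0)// powRrM Ma powR_mulrn ?(ltW B0).
rewrite expRN [leRHS](_ : _ = B ^+ j)//; field.
by rewrite !gt_eqF// expR_gt0.
Qed.

(* Since [ppow a] vanishes there, this is the initial value 1 on the negative
   half-line, and the function is continuous on the whole line. *)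
Definition mlf s : R := mittag_leffler a 1 (- g * ppow a s).

Lemma continuous_ppow : continuous (ppow a).
Proof.
move=> s; have [s0|s0|<-] := ltgtP 0 s.
- apply/cvgrPdist_le => e e0.
  have := is_derive1_cvg (is_derive1_powR a s0) => /cvgrPdist_le/(_ e e0) h.
  near=> y; rewrite !ppow_powR//; first by near: y.
  by near: y; exact: lt_nbhsr.
- apply: cvg_near_cst; near=> y; rewrite !ppow_le0// ?ltW//.
  by near: y; exact: lt_nbhsl.
- rewrite /continuous_at ppow_le0//; apply/cvgrPdist_le => e e0; near=> y.
  rewrite sub0r normrN ger0_norm ?ppow_ge0//.
  have [y0|y0] := ltP 0 y; last by rewrite ppow_le0// ltW.
  have -> : e = (e `^ a^-1) `^ a by rewrite -powRrM mulVf ?powRr1 ?(ltW e0)// gt_eqF.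
  rewrite ppow_powR// ge0_ler_powR ?nnegrE ?powR_ge0 ?ltW//.
  by near: y; apply: lt_nbhsl; rewrite powR_gt0.
Unshelve. all: by end_near. Qed.

Lemma mlfE s : mlf s = limn (pseries ml_coef (- g * ppow a s)).
Proof. by []. Qed.

Lemma continuous_mlf : continuous mlf.
Proof.
move=> s; apply: continuous_comp; last first.
  exact/is_derive1_cvg/(is_derive_entire _ entire_ml_coef).
apply: cvgMr; exact: continuous_ppow.
Qed.

Lemma mlf_le0 s : s <= 0 -> mlf s = 1.
Proof.
move=> s0; rewrite mlfE ppow_le0// mulr0; apply/cvg_lim => //.
(* The empty partial sum is 0; only the shifted sequence is constant. *)
rewrite -(cvg_shiftS _); apply: cvg_near_cst; apply: nearW => n.
rewrite /pseries /series/= big_nat_recl//= expr0 mulr1 big1 ?addr0.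
  by rewrite /ml_coef mulr0 add0r Gamma1 invr1.
by move=> i _; rewrite expr0n/= mulr0.
Qed.

Lemma derivable_mlf s : 0 < s -> derivable mlf s 1.
Proof.
move=> s0; apply: (@near_eq_derivable _ _ _ ((fun x => limn (pseries ml_coef x)) \o (fun s => - g * s `^ a))) => //.
  near=> y; rewrite mlfE/= ppow_powR//.
  by near: y; exact: lt_nbhsr.
have h1 := is_derive_entire (- g * s `^ a) entire_ml_coef.
have h2 : is_derive s 1 (fun s => - g * s `^ a) (- g * (a * s `^ (a - 1))).
  have h := is_derive1_powR a s0.
  by apply: is_deriveZ.
by case: (@is_derive1_comp _ _ (fun s => - g * s `^ a) _ _ _ h1 h2).
Unshelve. all: by end_near. Qed.

End mittag_leffler_fun.

(** * Abel integral equation *)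

Section kernel.
Context {R : realType}.
Implicit Types b p s t M : R.
Local Notation mu := (@lebesgue_measure R).

Lemma bounded_on_le (D : set R) (u : R -> R) M :
  (forall s, D s -> `|u s| <= M) -> [bounded u s | s in D].
Proof.
move=> uM; exists M; split; first exact: num_real.
by move=> N MN s Ds; exact: le_trans (uM s Ds) (ltW MN).
Qed.

Lemma integral_ppow_sub p b t : -1 < p ->
  (\int[mu]_(s in `]b, t]) (ppow p (t - s))%:E = (ppow (p + 1) (t - b) / (p + 1))%R%:E)%E.
Proof.
move=> p1; have p10 : 0 < p + 1 by lra.
(* [ppow (1 - 1)] is the indicator of the positive half-line, so after the reflection s -> t - s the
   integral is a convolution with Beta parameter 1. *)
pose h v := (ppow (p + 1 - 1) v * ppow (1 - 1) ((t - b) - v))%:E.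
transitivity (\int[mu]_s h (-1 * s + t)%R)%E.
  rewrite integral_mkcond; apply: eq_integral => s _.
  rewrite patchE /h/= addrK subrr mulN1r (addrC (- s)).
  have -> : t - b - (t - s) = s - b by ring.
  case: ifPn.
    rewrite inE/= in_itv/= => /andP[bs st].
    by rewrite [ppow 0 _]ppow_powR ?subr_gt0// powRr0 mulr1.
  rewrite notin_setE/= in_itv/= => /negP; rewrite negb_and -!leNgt -ltNge => /orP[sb|ts].
    by rewrite [ppow 0 _]ppow_le0 ?mulr0// subr_le0.
  by rewrite ppow_le0 ?mul0r// subr_le0 ltW.
rewrite ge0_integral_affine ?oppr_eq0 ?oner_eq0//; first last.
- by move=> v; rewrite lee_fin mulr_ge0// ppow_ge0.
- apply/measurable_EFinP; apply: measurable_funM; first exact: measurable_ppow.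
  by apply: (measurableT_comp (measurable_ppow _)); exact: measurable_funB.
rewrite normrN1 invr1 mul1e /h ppow_convolution ebeta1// -EFinM; congr EFin.
by congr (ppow _ _ / _); ring.
Qed.

Lemma measurable_ppow_sub p t (D : set R) : measurable_fun D (fun s => ppow p (t - s)).
Proof.
apply: measurable_funTS.
by apply: (measurableT_comp (measurable_ppow _)); exact: measurable_funB.
Qed.

Lemma integrable_ppow_sub p b t : -1 < p ->
  mu.-integrable `]b, t] (EFin \o (fun s => ppow p (t - s))).
Proof.
move=> p1; apply/integrableP; split.
  by apply/measurable_EFinP; exact: measurable_ppow_sub.
under eq_integral do rewrite /= ger0_norm ?ppow_ge0//.
by rewrite integral_ppow_sub// ltry.
Qed.

Lemma integrable_ppow_subM p b t (u : R -> R) M : -1 < p ->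
  measurable_fun `]b, t] u -> (forall s, b < s <= t -> `|u s| <= M) ->
  mu.-integrable `]b, t] (EFin \o (fun s => ppow p (t - s) * u s)).
Proof.
move=> p1 mu_ uM.
have -> : EFin \o (fun s => ppow p (t - s) * u s) =
    ((EFin \o (fun s => ppow p (t - s))) \* (EFin \o u))%E by apply/funext => s; rewrite /= EFinM.
apply: integrableMl => //; first exact: integrable_ppow_sub.
by apply: (@bounded_on_le _ _ M) => s /=; rewrite in_itv/=; exact: uM.
Qed.

Lemma Rintegral_ppow_sub p b t : -1 < p ->
  \int[mu]_(s in `]b, t]) ppow p (t - s) = ppow (p + 1) (t - b) / (p + 1).
Proof. by move=> p1; rewrite /Rintegral integral_ppow_sub. Qed.

Lemma integral_ppow p t : -1 < p ->
  (\int[mu]_(s in `]0%R, t]) (ppow p s)%:E = (ppow (p + 1) t / (p + 1))%R%:E)%E.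
Proof.
move=> p1; have p10 : 0 < p + 1 by lra.
rewrite -integral_itv_bndo_bndc; last first.
  by apply/measurable_EFinP; apply: measurable_funTS; exact: measurable_ppow.
transitivity (\int[mu]_s (ppow (p + 1 - 1) s * ppow (1 - 1) (t - s))%:E)%E.
  rewrite integral_mkcond; apply: eq_integral => s _.
  rewrite patchE /= addrK subrr; case: ifPn.
    rewrite inE/= in_itv/= => /andP[bs st].
    by rewrite [ppow 0 _]ppow_powR ?subr_gt0// powRr0 mulr1.
  rewrite notin_setE/= in_itv/= => /negP; rewrite negb_and -!leNgt => /orP[s0|ts].
    by rewrite ppow_le0 ?mul0r.
  by rewrite [ppow 0 _]ppow_le0 ?mulr0// subr_le0.
by rewrite ppow_convolution ebeta1// -EFinM addrK.
Qed.

Lemma Rintegral_ppow_beta p q t : -1 < p -> -1 < q ->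
  \int[mu]_(s in `]0, t]) (ppow q (t - s) * ppow p s) =
  ppow (p + q + 1) t * (Gamma (p + 1) * Gamma (q + 1) / Gamma (p + q + 2)).
Proof.
move=> p1 q1; rewrite /Rintegral.
transitivity (fine (\int[mu]_s (ppow (p + 1 - 1) s * ppow (q + 1 - 1) (t - s))%:E)%E).
  congr fine; rewrite integral_mkcond; apply: eq_integral => s _.
  rewrite patchE /= !addrK; case: ifPn; first by rewrite mulrC.
  rewrite notin_setE/= in_itv/= => /negP; rewrite negb_and -leNgt -ltNge => /orP[s0|ts].
    by rewrite ppow_le0 ?mul0r.
  by rewrite (@ppow_le0 _ q) ?mulr0// subr_le0 ltW.
rewrite ppow_convolution ebetaE; [|lra|lra].
by rewrite -EFinM/=; congr (ppow _ _ * (_ / Gamma _)); ring.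
Qed.

(** Dominated convergence with a weight, to be used both with the singular Abel kernel and with the
    weight 1. *)
Lemma cvg_Rintegral_bounded (D : set R) (w f : R -> R) (F : nat -> R -> R) M :
  measurable D -> mu.-integrable D (EFin \o w) -> (forall s, D s -> 0 <= w s) ->
  (forall n, measurable_fun D (F n)) -> measurable_fun D f ->
  (forall n s, D s -> `|F n s| <= M) ->
  (forall s, D s -> F n s @[n --> \oo] --> f s) ->
  \int[mu]_(s in D) (w s * F n s) @[n --> \oo] --> \int[mu]_(s in D) (w s * f s).
Proof.
move=> mD iw w0 mF mf FM Ff.
have mw : measurable_fun D w by apply/measurable_EFinP; case/integrableP: iw.
have mwF n : measurable_fun D (fun s => (w s * F n s)%:E).
  by apply/measurable_EFinP; exact: measurable_funM.
have mwf : measurable_fun D (fun s => (w s * f s)%:E).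
  by apply/measurable_EFinP; exact: measurable_funM.
have iwM : mu.-integrable D (fun s => (w s * M)%:E).
  rewrite (_ : (fun s => _) = (fun s => (EFin \o w) s * M%:E)%E).
    exact: integrableZr.
  by apply/funext => s; rewrite /= EFinM.
have cwF : \forall s \ae mu, D s -> (w s * F n s)%:E @[n --> \oo] --> (w s * f s)%:E.
  apply: aeW => s Ds; apply: cvg_EFin; first exact: nearW.
  by apply: cvgMr; exact: Ff.
have bwF : \forall s \ae mu, forall n, D s -> (`|(w s * F n s)%:E| <= (w s * M)%:E)%E.
  apply: aeW => s n Ds; rewrite lee_fin normrM ger0_norm ?w0//.
  by rewrite ler_wpM2l ?w0// FM.
have [||i _ h] := @dominated_convergence _ _ _ mu D mD _ _ _ mwF mwf _ iwM _.
- exact: cwF.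
- exact: bwF.
by apply: fine_cvg; rewrite fineK//; exact: integrable_fin_num.
Qed.

End kernel.

Section volterra.
Context {R : realType}.
Variables (a g : R).
Hypotheses (a0 : 0 < a) (a1 : a < 1) (g0 : 0 < g).
Implicit Types s t b : R.
Local Notation mu := (@lebesgue_measure R).

(** Unnormalised Abel integral of order 1 - a. The lower limit [b] is a parameter because the
    monotonicity argument lets the history begin at a negative time. *)
Definition abel (u : R -> R) b t : R :=
  \int[mu]_(s in `]b, t]) (ppow (- a) (t - s) * u s).

Let c j := ml_coef a j * (- g) ^+ j.
(** The partial sums are written in powers s^(a j), so that Euler's Beta integral applies to each
    term. They vanish for s <= 0, where [mlf] is 1, hence approximate it only on the positive
    half-line. *)
Let S n s : R := \sum_(0 <= j < n) (c j * ppow (a * j%:R) s).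

Let S_pseries n s : 0 < s -> S n s = pseries (ml_coef a) (- g * ppow a s) n.
Proof.
move=> s0; rewrite /S /pseries /series/=; apply: eq_bigr => j _.
rewrite /c -mulrA exprMn; congr (_ * (_ * _)).
by rewrite !ppow_powR// powRrM powR_mulrn ?powR_ge0.
Qed.

Let aN1 : -1 < - a. Proof. by rewrite ltrN2. Qed.

Let aj j : -1 < a * j%:R.
Proof. by rewrite (lt_le_trans (ltrN10 R))// mulr_ge0// ltW. Qed.

Let ppow_bound p s t : 0 <= p -> 0 < s <= t -> `|ppow p s| <= t `^ p.
Proof.
move=> p0 /andP[s0 st]; rewrite ger0_norm ?ppow_ge0// ppow_powR//.
by rewrite ge0_ler_powR// nnegrE ltW// (lt_le_trans s0).
Qed.

Let ij j t : mu.-integrable `]0, t] (EFin \o (fun s => ppow (- a) (t - s) * ppow (a * j%:R) s)).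
Proof.
apply: integrable_ppow_subM => //; first by apply: measurable_funTS; exact: measurable_ppow.
by move=> s; apply: ppow_bound; rewrite mulr_ge0// ltW.
Qed.

Let ij0 j t : mu.-integrable `]0, t] (EFin \o (fun s => ppow (a * j%:R) s)).
Proof.
apply/integrableP; split.
  by apply/measurable_EFinP; apply: measurable_funTS; exact: measurable_ppow.
under eq_integral do rewrite /= ger0_norm ?ppow_ge0//.
by rewrite integral_ppow// ltry.
Qed.

Let Rintegral_lin (w : R -> R) n t :
  (forall j, mu.-integrable `]0, t] (EFin \o (fun s => w s * ppow (a * j%:R) s))) ->
  mu.-integrable `]0, t] (EFin \o (fun s => w s * S n s)) /\
  \int[mu]_(s in `]0, t]) (w s * S n s) =
  \sum_(0 <= j < n) (c j * \int[mu]_(s in `]0, t]) (w s * ppow (a * j%:R) s)).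
Proof.
move=> iw; elim: n => [|n [IH1 IH2]].
  rewrite (_ : (fun s => _) = fun=> 0); last by apply/funext => s; rewrite /S big_nil mulr0.
  split; first exact: integrable0.
  by rewrite Rintegral_cst// mul0r big_nil.
have E : (fun s => w s * S n.+1 s) =
    (fun s => w s * S n s + c n * (w s * ppow (a * n%:R) s)).
  by apply/funext => s; rewrite /S big_nat_recr//=; ring.
have i2 : mu.-integrable `]0, t] (EFin \o (fun s => c n * (w s * ppow (a * n%:R) s))).
  rewrite (_ : EFin \o _ = (fun s => (c n)%:E * (w s * ppow (a * n%:R) s)%:E)%E).
    by apply: integrableZl => //; exact: iw.
  by apply/funext => s; rewrite /= EFinM.
rewrite E; split.
  rewrite (_ : EFin \o _ = ((EFin \o (fun s => w s * S n s)%R) \+ (EFin \o (fun s => c n * (w s * ppow (a * n%:R) s))%R))%E).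
    exact: integrableD.
  by apply/funext => s; rewrite /= EFinD.
by rewrite RintegralD// IH2 RintegralZl// big_nat_recr.
Qed.

Lemma abel_mlf t : 0 < t ->
  abel (mlf a g) 0 t =
  t `^ (1 - a) / (1 - a) - g * Gamma (1 - a) * \int[mu]_(s in `]0, t]) mlf a g s.
Proof.
move=> t0; have X0 : 0 <= g * t `^ a by rewrite mulr_ge0 ?powR_ge0 ?ltW.
have [M HM] := entire_bounded X0 (entire_ml_coef a0).
have mS n D : measurable_fun D (S n).
  apply: measurable_sum => j; apply: measurable_funM => //.
  by apply: measurable_funTS; exact: measurable_ppow.
have mf D : measurable_fun D (mlf a g).
  apply: measurable_funTS; apply: continuous_measurable_fun; exact: continuous_mlf.
have SM n s : `]0, t]%classic s -> `|S n s| <= M.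
  rewrite /= in_itv/= => /andP[s0 st]; rewrite S_pseries//; apply: HM.
  rewrite normrM normrN (gtr0_norm g0) ler_pM2l//; apply: ppow_bound; rewrite ?(ltW a0)//.
  by rewrite s0.
have Sf s : `]0, t]%classic s -> S n s @[n --> \oo] --> mlf a g s.
  rewrite /= in_itv/= => /andP[s0 st].
  rewrite mlfE (_ : (fun n => S n s) = pseries (ml_coef a) (- g * ppow a s)).
    exact: is_cvg_entire (entire_ml_coef a0).
  by apply/funext => n; rewrite S_pseries.
have mI : measurable (`]0, t]%classic : set R) by [].
have C1 := @cvg_Rintegral_bounded R _ (fun s => ppow (- a) (t - s)) _ _ M mI
  (integrable_ppow_sub _ _ aN1) (fun s _ => ppow_ge0 _ _) (fun n => mS n _) (mf _) SM Sf.
have i1 : mu.-integrable `]0, t] (EFin \o cst (1 : R)).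
  have := ij0 0 t; apply: eq_integrable => // s; rewrite inE/= in_itv/= => /andP[s0 _].
  by rewrite mulr0 ppow_powR// powRr0.
have C2 := @cvg_Rintegral_bounded R _ (cst 1) _ _ M mI i1 (fun s _ => ler01) (fun n => mS n _) (mf _) SM Sf.
have {}C2 : \int[mu]_(s in `]0, t]) (1 * S n s) @[n --> \oo] --> \int[mu]_(s in `]0, t]) mlf a g s.
  by rewrite (_ : mlf a g = (fun s => 1 * mlf a g s))//; apply/funext => s; rewrite mul1r.
(* Index shift: the Abel integral of term j + 1 is -g Gamma(1-a) times the plain integral of term j,
   because Gamma(a j + 2) = (a j + 1) Gamma(a j + 1). Term 0 gives the forcing t^(1-a) / (1-a). *)
have rec n : \int[mu]_(s in `]0, t]) (ppow (- a) (t - s) * S n.+1 s) =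
    t `^ (1 - a) / (1 - a) - g * Gamma (1 - a) * \int[mu]_(s in `]0, t]) (1 * S n s).
  have [_ ->] := Rintegral_lin n.+1 (ij ^~ t).
  have ij1 j : mu.-integrable `]0, t] (EFin \o (fun s => (1:R) * ppow (a * j%:R) s)).
    by under [X in EFin \o X]eq_fun do rewrite mul1r; exact: ij0.
  have [_ ->] := Rintegral_lin n ij1.
  rewrite big_nat_recl//; congr (_ + _).
    rewrite Rintegral_ppow_beta// /c /ml_coef mulr0 !add0r expr0 mulr1.
    have -> : Gamma (- a + 2) = (1 - a) * Gamma (- a + 1).
      rewrite addrC (_ : 2 - a = (1 - a) + 1); last by ring.
      by rewrite GammaS ?subr_gt0// (addrC (- a)).
    rewrite (addrC (- a) 1) ppow_powR// Gamma1.
    have G0 : Gamma (1 - a) != 0 by rewrite gt_eqF// Gamma_gt0// subr_gt0.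
    by field; rewrite G0 subr_eq0 gt_eqF.
  rewrite -mulNr mulr_sumr; apply: eq_bigr => j _.
  rewrite Rintegral_ppow_beta//; under eq_Rintegral do rewrite mul1r.
  rewrite [X in c j * X]/Rintegral integral_ppow//=.
  have E1 : a * j.+1%:R - a + 1 = a * j%:R + 1 by rewrite -natr1; ring.
  have E2 : a * j.+1%:R - a + 2 = (a * j%:R + 1) + 1 by rewrite -natr1; ring.
  rewrite E1 E2 (GammaS (ml_coef_arg_gt0 a0 j)) /c /ml_coef exprS (addrC (- a)).
  have Gn k : Gamma (a * k%:R + 1) != 0 by rewrite gt_eqF// Gamma_gt0// ml_coef_arg_gt0.
  have j0 : a * j%:R + 1 != 0 by rewrite gt_eqF// ml_coef_arg_gt0.
  by field; rewrite !Gn j0.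
have C1' : \int[mu]_(s in `]0, t]) (ppow (- a) (t - s) * S n.+1 s) @[n --> \oo]
    --> abel (mlf a g) 0 t by rewrite (cvg_shiftS (fun n => _)).
apply: (cvg_unique _ C1') => //.
rewrite (funext rec).
by apply: cvgB; [exact: cvg_cst | apply: cvgMr].
Qed.

End volterra.

(** * Minimum principle for Abel integrals *)

Section minimum_principle.
Context {R : realType}.
Variable a : R.
Hypotheses (a0 : 0 < a) (a1 : a < 1).
Local Notation mu := (@lebesgue_measure R).

Let aN1 : -1 < - a. Proof. by rewrite ltrN2. Qed.

Lemma Rintegral_itv_split (f : R -> R) (b c d : R) : b <= c <= d ->
  mu.-integrable `]b, d] (EFin \o f) ->
  \int[mu]_(s in `]b, d]) f s = \int[mu]_(s in `]b, c]) f s + \int[mu]_(s in `]c, d]) f s.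
Proof.
move=> /andP[bc cd] i; rewrite -(@Rintegral_itvB _ f _ _ c i) ?bnd_simp//.
by rewrite addrC subrK.
Qed.

Lemma Rintegral_cst_itv (b d k : R) : b <= d -> \int[mu]_(s in `]b, d]) k = k * (d - b).
Proof.
move=> bd; rewrite Rintegral_cst//= lebesgue_measure_itv/= lte_fin.
by case: ltgtP bd => // -> _; rewrite subrr.
Qed.

(** On ]b, t[ the kernel decreases from time [t] to time [t0], so [u] may be replaced there by its
    minimum [u t0]; on ]t, t0] it is at most u(t0) + K (t0 - t). The terms in [u t0] add up to
    [u t0] times the increment of the integral of the kernel, which is nonnegative, so together they
    are at most 0. *)
Lemma abel_increment_le (u : R -> R) (b t t0 M K : R) :
  b < t -> t < t0 -> 0 <= K ->
  measurable_fun [set: R] u -> (forall s, b < s <= t0 -> `|u s| <= M) ->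
  (forall s, b < s <= t0 -> u t0 <= u s) -> u t0 <= 0 ->
  (forall s, t < s <= t0 -> u s - u t0 <= K * (t0 - s)) ->
  abel a u b t0 - abel a u b t <= K * (t0 - t) * ((t0 - t) `^ (1 - a) / (1 - a)).
Proof.
move=> bt tt0 K0 mu_ uM umin u0 uK.
have i0 : mu.-integrable `]b, t0] (EFin \o (fun s => ppow (- a) (t0 - s) * u s)).
  by apply: (integrable_ppow_subM aN1 _ uM); exact: measurable_funTS.
have i1 : mu.-integrable `]b, t] (EFin \o (fun s => ppow (- a) (t - s) * u s)).
  apply: (@integrable_ppow_subM _ _ _ _ _ M) => //; first exact: measurable_funTS.
  by move=> s /andP[bs st]; apply: uM; rewrite bs/= (le_trans st)// ltW.
have s1 : `]b, t[ `<=` `]b, t0].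
  by move=> s /=; rewrite !in_itv/= => /andP[-> /ltW st]; rewrite (le_trans st)// ltW.
have s1' : `]b, t[ `<=` `]b, t] by apply: subset_itvl; rewrite bnd_simp.
have s2 : `]t, t0] `<=` `]b, t0] by apply: subset_itvr; rewrite bnd_simp ltW.
have k0 : mu.-integrable `]b, t0] (EFin \o (fun s => ppow (- a) (t0 - s))) by exact: integrable_ppow_sub.
have k1 : mu.-integrable `]b, t] (EFin \o (fun s => ppow (- a) (t - s))) by exact: integrable_ppow_sub.
rewrite /abel (@Rintegral_itv_split _ b t t0)//; last by rewrite !ltW.
(* At s = t the convention gives [ppow (- a) 0 = 0] instead of infinity, so the kernels compare the
   wrong way at that point; it is removed from the interval. *)
have oc (f : R -> R) : mu.-integrable `]b, t] (EFin \o f) ->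
    \int[mu]_(s in `]b, t]) f s = \int[mu]_(s in `]b, t[) f s.
  by move=> i; rewrite Rintegral_itv_bndo_bndc//; exact: integrableS i.
rewrite addrAC oc; last first.
  apply: integrableS i0 => //.
  by move=> s /=; rewrite !in_itv/= => /andP[-> st]; rewrite (le_trans st)// ltW.
rewrite (oc _ i1) -RintegralB//; [|exact: integrableS i0|exact: integrableS i1].
have L p : 0 < p -> ppow (- a + 1) p / (- a + 1) = p `^ (1 - a) / (1 - a).
  by move=> p0; rewrite ppow_powR// (addrC (- a)).
apply: (@le_trans _ _ (\int[mu]_(s in `]b, t[) ((ppow (- a) (t0 - s) - ppow (- a) (t - s)) * u t0)
   + \int[mu]_(s in `]t, t0]) (ppow (- a) (t0 - s) * (u t0 + K * (t0 - t))))).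
  apply: lerD.
    apply: le_Rintegral => //.
    - rewrite (_ : EFin \o _ = ((EFin \o (fun s => ppow (- a) (t0 - s) * u s)%R) \- (EFin \o (fun s => ppow (- a) (t - s) * u s)%R))%E).
        by apply: integrableB => //; [exact: integrableS i0|exact: integrableS i1].
      by apply/funext => s; rewrite /= EFinB.
    - rewrite (_ : EFin \o _ = (fun s => ((EFin \o (fun s => ppow (- a) (t0 - s))%R) \- (EFin \o (fun s => ppow (- a) (t - s))%R)) s * (u t0)%:E)%E).
        by apply: integrableZr => //; apply: integrableB => //; [exact: integrableS k0|exact: integrableS k1].
      by apply/funext => s; rewrite /= EFinM EFinB.
    - move=> s /=; rewrite in_itv/= => /andP[bs st].
      rewrite -mulrBl ler_wnM2l//.
        have st' : 0 < t - s by rewrite subr_gt0.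
        have st0 : 0 < t0 - s by rewrite subr_gt0 (lt_trans st).
        rewrite subr_le0 !ppow_powR// !powRN lef_pV2 ?posrE ?powR_gt0//.
        by apply: ge0_ler_powR; rewrite ?nnegrE ?(ltW a0) ?(ltW st') ?(ltW st0)// lerD2r ltW.
      by rewrite umin// bs/= ltW// (lt_trans st).
  apply: le_Rintegral => //.
  - exact: integrableS i0.
  - rewrite (_ : EFin \o _ = (fun s => (ppow (- a) (t0 - s))%:E * (u t0 + K * (t0 - t))%:E)%E).
      by apply: integrableZr => //; exact: integrable_ppow_sub.
    by apply/funext => s; rewrite /= EFinM.
  - move=> s /=; rewrite in_itv/= => /andP[ts st0].
    rewrite ler_wpM2l ?ppow_ge0// -lerBlDl (le_trans (uK _ _)) ?ts//.
    by rewrite ler_wpM2l// lerD2l lerN2 ltW.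
rewrite RintegralZr//; last first.
  rewrite (_ : EFin \o _ = ((EFin \o (fun s => ppow (- a) (t0 - s))%R) \- (EFin \o (fun s => ppow (- a) (t - s))%R))%E).
    by apply: integrableB => //; [exact: integrableS k0|exact: integrableS k1].
  by apply/funext => s; rewrite /= EFinB.
rewrite RintegralZr//; last exact: integrable_ppow_sub.
rewrite RintegralB//; [|exact: integrableS k0|exact: integrableS k1].
rewrite -!oc//; last first.
  apply: integrableS k0 => //.
  by move=> s /=; rewrite !in_itv/= => /andP[-> st]; rewrite (le_trans st)// ltW.
have := @Rintegral_itv_split (fun s => ppow (- a) (t0 - s)) b t t0 _ k0.
rewrite !Rintegral_ppow_sub// !L ?subr_gt0// ?(lt_trans bt)//.
move=> /(_ ltac:(by rewrite !ltW)) E.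
have mono : (t - b) `^ (1 - a) / (1 - a) <= (t0 - b) `^ (1 - a) / (1 - a).
  rewrite ler_wpM2r ?invr_ge0 ?subr_ge0 ?(ltW a1)//.
  by apply: ge0_ler_powR; rewrite ?nnegrE ?subr_ge0 ?(ltW a1) ?(ltW bt) ?(ltW (lt_trans bt tt0))// lerD2r ltW.
rewrite mulrDr addrA -mulrDl addrAC -E mulrC [X in _ + X]mulrC.
by rewrite gerDr mulr_le0_ge0// subr_ge0.
Qed.

(* At a negative minimum, the history of [u] pushes its Abel integral down by
   at most [O(e^(2-a))] over a step [e], while the right-hand side forces it up
   at a linear rate. *)
Lemma abel_minimum_principle (G : R) (u : R -> R) (b b' t0 M : R) :
  0 < G -> b <= b' -> b' < t0 -> measurable_fun [set: R] u ->
  (forall s, b < s <= t0 -> `|u s| <= M) ->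
  (forall s, b < s <= t0 -> u t0 <= u s) ->
  derivable u t0 1 ->
  (forall t, b' < t < t0 ->
    - G * \int[mu]_(s in `]t, t0]) u s <= abel a u b t0 - abel a u b t) ->
  0 <= u t0.
Proof.
move=> G0 bb' bt0 mu_ uM umin du H; rewrite leNgt; apply/negP => u0.
(* Differentiability at [t0] enters as a one-sided Lipschitz bound, with K = 1 + |l| for l the
   derivative. *)
have [K K0 [d d0 uK]] : exists2 K, 0 <= K & exists2 d, 0 < d &
    forall s, t0 - d < s <= t0 -> u s - u t0 <= K * (t0 - s).
  move/cvg_ex : du => [l /cvgrPdist_le/(_ 1 ltr01)].
  rewrite /dnbhs/= near_withinE => /nbhs_ballP[d/= d0 dl].
  exists (1 + `|l|); first by rewrite addr_ge0.
  exists d => // s /andP[ds]; rewrite le_eqVlt => /predU1P[->|st0].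
    by rewrite !subrr mulr0.
  have h0 : s - t0 != 0 by rewrite subr_eq0 lt_eqF.
  have := dl (s - t0); rewrite /ball/= sub0r normrN ltr0_norm ?subr_lt0// opprB.
  move=> /(_ _ h0); rewrite /GRing.scale/= mulr1 subrK => /(_ _)/wrap[]; first lra.
  rewrite distrC => h.
  have {h} : `|(s - t0)^-1 * (u s - u t0)| <= 1 + `|l|.
    rewrite -lerBlDr; apply: le_trans h; exact: lerB_dist.
  rewrite normrM normfV [`|s - t0|]ltr0_norm ?subr_lt0// opprB ler_pdivrMl ?subr_gt0// => h.
  by rewrite mulrC (le_trans _ h)// ler_norm.
pose m := - u t0; have m0 : 0 < m by rewrite oppr_gt0.
have a1' : 0 < 1 - a by rewrite subr_gt0.
(* K e < m/2 keeps u below -m/2 on ]t0 - e, t0], so [H] forces an increment of at least G e m/2,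
   while the previous lemma allows at most K e e^(1-a) / (1-a). The last condition makes these
   incompatible after division by e. *)
have : \forall e \near 0^'+, [/\ 0 < e, e < t0 - b', e < d, K * e < m / 2 &
    K * (e `^ (1 - a) / (1 - a)) < G * (m / 2)].
  near=> e; have e0 : 0 < e by near: e; exact: nbhs_right_gt.
  split => //.
  - by near: e; apply: nbhs_right_lt; rewrite subr_gt0.
  - have : e < m / 2 / (K + 1) by near: e; apply: nbhs_right_lt; rewrite !divr_gt0// ltr_wpDl.
    rewrite ltr_pdivlMr ?ltr_wpDl// => h; apply: le_lt_trans h.
    by rewrite mulrC ler_wpM2l ?lerDl// ltW.
  - near: e; have k0 : 0 < G * (m / 2) * (1 - a) / (K + 1).
      by rewrite divr_gt0 ?ltr_wpDl// mulr_gt0// mulr_gt0// divr_gt0.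
    have /cvgr0Pnorm_lt/(_ _ k0) := powR_cvg0 a1'.
    apply: filterS => e; rewrite ger0_norm ?powR_ge0// ltr_pdivlMr ?ltr_wpDl// => h.
    rewrite mulrA ltr_pdivrMr//; apply: le_lt_trans h.
    by rewrite mulrC ler_wpM2l ?powR_ge0 ?lerDl.
move=> /(@filter_ex _ (0^'+)) [e [e0 eb ed eK eKa]].
have bt : b' < t0 - e by lra.
have bt' := le_lt_trans bb' bt.
have tt0 : t0 - e < t0 by lra.
have uK' s : t0 - e < s <= t0 -> u s - u t0 <= K * (t0 - s).
  by move=> /andP[es st0]; apply: uK; rewrite st0 andbT; lra.
have h1 := abel_increment_le bt' tt0 K0 mu_ uM umin (ltW u0) uK'.
have h2 := H (t0 - e); rewrite bt tt0 in h2; move: h2 => /(_ isT) h2.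
have h3 : \int[mu]_(s in `]t0 - e, t0]) u s <= (u t0 + K * e) * (t0 - (t0 - e)).
  rewrite -Rintegral_cst_itv; last by lra.
  apply: le_Rintegral => //.
  - apply: measurable_bounded_integrable => //.
    + by rewrite /= lebesgue_measure_itv/=; case: ifP => _; rewrite ?ltry// -EFinB ltry.
    + exact: measurable_funTS.
    + apply: (@bounded_on_le _ _ _ M) => s /=; rewrite in_itv/= => /andP[es st0].
      by apply: uM; rewrite st0 andbT; lra.
  - apply: measurable_bounded_integrable => //.
    + by rewrite /= lebesgue_measure_itv/=; case: ifP => _; rewrite ?ltry// -EFinB ltry.
    + by apply: (@bounded_on_le _ _ _ `|u t0 + K * e|).
  - move=> s /=; rewrite in_itv/= => es; have := uK' s es.
    have /andP[es1 es2] := es.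
    have : K * (t0 - s) <= K * e by rewrite ler_wpM2l//; lra.
    lra.
rewrite (_ : t0 - (t0 - e) = e) in h1 h3; last by ring.
have h4 : G * (m - K * e) <= K * (e `^ (1 - a) / (1 - a)).
  rewrite -(ler_pM2r e0).
  have := ler_wpM2l (ltW G0) h3; move: h1 h2; rewrite /m.
  set L := _ / _; set I := \int[_]_(_ in _) _; set A := abel _ _ _ _; set A' := abel _ _ _ _.
  have -> : K * e * L = K * L * e by ring.
  have -> : G * (- u t0 - K * e) * e = - (G * ((u t0 + K * e) * e)) by ring.
  lra.
have : G * (m / 2) <= G * (m - K * e) by rewrite ler_pM2l//; lra.
lra.
Unshelve. all: by end_near. Qed.

End minimum_principle.

(** * Translations, and continuous functions on bounded intervals *)

Section shift.
Context {R : realType}.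
Local Notation mu := (@lebesgue_measure R).

Lemma ge0_Rintegral_shift (h : R -> R) (b t d : R) :
  measurable_fun [set: R] h -> (forall s, 0 <= h s) ->
  \int[mu]_(s in `]b, t]) h (s + d) = \int[mu]_(s in `](b + d), (t + d)]) h s.
Proof.
move=> mh h0; rewrite /Rintegral; congr fine.
pose k s := ((h \_ `](b + d), (t + d)]) s)%:E.
have k0 s : (0 <= k s)%E by rewrite lee_fin patchE; case: ifPn.
have mk : measurable_fun [set: R] k.
  by apply/measurable_EFinP/measurable_restrict => //; exact: measurable_funTS.
transitivity (\int[mu]_s k (1 * s + d)%R)%E.
  rewrite integral_mkcond; apply: eq_integral => s _.
  rewrite /k !patchE mul1r.
  have -> : (s + d \in `](b + d), (t + d)]%classic) = (s \in `]b, t]%classic).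
    by apply/idP/idP; rewrite !inE/= !in_itv/= lerD2r ltrD2r.
  by case: ifPn.
rewrite ge0_integral_affine ?oner_eq0// normr1 invr1 mul1e [RHS]integral_mkcond.
by apply: eq_integral => s _; rewrite /k !patchE; case: ifPn.
Qed.

Lemma continuous_itv_bounded (u : R -> R) (b t : R) : continuous u ->
  exists M, forall s, b < s <= t -> `|u s| <= M.
Proof.
move=> cu; have [bt|tb] := leP b t; last first.
  by exists 0 => s /andP[bs st]; have := lt_le_trans bs st; rewrite ltNge (ltW tb).
have : {within `[b, t], continuous (fun s => `|u s|)}.
  by apply: continuous_subspaceT => s; apply: cvg_norm; exact: cu.
move=> /(EVT_max bt)[c _ hc]; exists `|u c| => s /andP[bs st].
by apply: hc; rewrite in_itv/= st ltW.
Qed.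

Lemma integrable_continuous_itv (u : R -> R) (b t : R) : continuous u ->
  mu.-integrable `]b, t] (EFin \o u).
Proof.
move=> cu; have [M HM] := continuous_itv_bounded b t cu.
apply: measurable_bounded_integrable => //.
- by rewrite /= lebesgue_measure_itv/=; case: ifP => _; rewrite ?ltry// -EFinB ltry.
- by apply: measurable_funTS; exact: continuous_measurable_fun.
- by apply: (@bounded_on_le _ _ _ M) => s /=; rewrite in_itv/=; exact: HM.
Qed.

End shift.

(** * Bounds and monotonicity of the Mittag-Leffler function *)

Section mlf_monotone.
Context {R : realType}.
Variables (a g : R).
Hypotheses (a0 : 0 < a) (a1 : a < 1) (g0 : 0 < g).
Implicit Types s t b d : R.
Local Notation mu := (@lebesgue_measure R).
Local Notation f := (mlf a g).

Let aN1 : -1 < - a. Proof. by rewrite ltrN2. Qed.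
Let p0 : 0 < 1 - a. Proof. by rewrite subr_gt0. Qed.

Definition abel_const : R := g * Gamma (1 - a).
Local Notation G := abel_const.

Lemma abel_const_gt0 : 0 < G.
Proof. by rewrite mulr_gt0// Gamma_gt0. Qed.

Let cf : continuous f. Proof. exact: continuous_mlf. Qed.
Let mf : measurable_fun [set: R] f. Proof. exact: continuous_measurable_fun. Qed.
Let if_ b t : mu.-integrable `]b, t] (EFin \o f). Proof. exact: integrable_continuous_itv. Qed.

Definition mlf_primitive t := \int[mu]_(s in `]0, t]) f s.
Local Notation F := mlf_primitive.

Lemma mlf_primitiveB t t' : 0 <= t <= t' -> F t' - F t = \int[mu]_(s in `]t, t']) f s.
Proof. by move=> tt; rewrite /F (Rintegral_itv_split tt)// addrAC subrr add0r. Qed.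

Lemma abel_mlfE t : 0 < t -> abel a f 0 t = t `^ (1 - a) / (1 - a) - G * F t.
Proof. by move=> t0; rewrite abel_mlf. Qed.

Let L_homo t t' : 0 <= t <= t' -> t `^ (1 - a) / (1 - a) <= t' `^ (1 - a) / (1 - a).
Proof.
move=> /andP[t0 tt']; rewrite ler_pM2r ?invr_gt0//.
by apply: ge0_ler_powR; rewrite ?nnegrE ?(ltW p0)// (le_trans t0).
Qed.

(** A negative minimum over [0, t] cannot sit at 0, where [u] is nonnegative; it is thus at a
    positive time, where differentiability is available. *)
Let min_on (u : R -> R) t : continuous u -> 0 < t -> u t < 0 -> 0 <= u 0 ->
  exists t0, [/\ 0 < t0, u t0 < 0 & forall s, 0 <= s <= t0 -> u t0 <= u s].
Proof.
move=> cu t0 ut u0.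
have /(EVT_min (ltW t0))[c] : {within `[0, t], continuous u} by apply: continuous_subspaceT.
rewrite in_itv/= => /andP[c0 ct] hc; exists c.
have uc : u c < 0 by apply: le_lt_trans ut; apply: hc; rewrite in_itv/= ltW/=.
split => //.
  by rewrite lt_neqAle c0 andbT; apply/eqP => c0'; move: uc; rewrite -c0' ltNge u0.
by move=> s /andP[s0 sc]; apply: hc; rewrite in_itv/= s0 (le_trans sc).
Qed.

(** The forcing t^(1-a) / (1-a) in the Abel equation is nondecreasing; dropping its increment leaves
    the inequality of the minimum principle. *)
Lemma mlf_ge0 t : 0 <= f t.
Proof.
have [t0|t0] := leP t 0; first by rewrite mlf_le0.
rewrite leNgt; apply/negP => ft.
have [|c [c0 fc fmin]] := min_on cf t0 ft; first by rewrite mlf_le0.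
have [M HM] := continuous_itv_bounded 0 c cf.
suff : 0 <= f c by rewrite leNgt fc.
apply: (@abel_minimum_principle _ a a0 a1 G f 0 0 c M abel_const_gt0 (lexx 0) c0 mf HM) => //.
- by move=> s /andP[s0 sc]; apply: fmin; rewrite sc ltW.
- exact: derivable_mlf.
- move=> s /andP[s0 sc]; rewrite !abel_mlfE//.
  rewrite -mlf_primitiveB; last by rewrite !ltW.
  have /L_homo : 0 <= s <= c by rewrite !ltW.
  rewrite mulNr mulrBr; lra.
Qed.

(** The Abel integral of u = 1 - f is G F, since the forcing is exactly the Abel integral of 1. Its
    increment over [s, c] is G (c - s) minus G times the integral of u, and the first term is
    nonnegative. *)
Lemma mlf_le1 t : f t <= 1.
Proof.
have [t0|t0] := leP t 0; first by rewrite mlf_le0.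
rewrite -subr_ge0 leNgt; apply/negP => ft.
pose u s := 1 - f s.
have cu : continuous u by move=> s; apply: cvgB; [exact: cvg_cst|exact: cf].
have [|c [c0 uc umin]] := min_on cu t0 ft; first by rewrite /u mlf_le0// subrr.
have [M HM] := continuous_itv_bounded 0 c cu.
have [Mf HMf] := continuous_itv_bounded 0 c cf.
suff : 0 <= u c by rewrite leNgt uc.
apply: (@abel_minimum_principle _ a a0 a1 G u 0 0 c M abel_const_gt0 (lexx 0) c0 (continuous_measurable_fun cu) HM) => //.
- by move=> s /andP[s0 sc]; apply: umin; rewrite sc ltW.
- by apply: derivableB => //; exact: derivable_mlf.
- have E s : 0 < s <= c -> abel a u 0 s = G * F s.
    move=> /andP[s0 sc]; rewrite /abel.
    transitivity (\int[mu]_(v in `]0, s]) (ppow (- a) (s - v) - ppow (- a) (s - v) * f v)).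
      by apply: eq_Rintegral => v _; rewrite /u mulrBr mulr1.
    rewrite RintegralB//; first last.
    + apply: (@integrable_ppow_subM _ _ _ _ _ Mf) => //; first exact: measurable_funTS.
      by move=> v /andP[v0 vs]; apply: HMf; rewrite v0 (le_trans vs).
    + exact: integrable_ppow_sub.
    rewrite Rintegral_ppow_sub// subr0 -/(abel a f 0 s) abel_mlfE//.
    by rewrite ppow_powR// (addrC (- a)); ring.
  move=> s /andP[s0 sc]; rewrite !E ?c0 ?s0 ?(ltW sc) ?lexx//.
  have E2 : \int[mu]_(v in `]s, c]) u v = (c - s) - \int[mu]_(v in `]s, c]) f v.
    rewrite /u RintegralB//; last exact/integrable_continuous_itv/cst_continuous.
    by rewrite Rintegral_cst_itv ?ltW// mul1r.
  rewrite -mulrBr mlf_primitiveB; last by rewrite !ltW.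
  rewrite E2; set I := Rintegral _ _ _.
  have : 0 <= G * (c - s) by rewrite mulr_ge0 ?subr_ge0 ?ltW// abel_const_gt0.
  rewrite mulNr !mulrBr; lra.
Qed.

Lemma mlf_bound1 s : `|f s| <= 1.
Proof. by rewrite ger0_norm ?mlf_ge0 ?mlf_le1. Qed.

(** On ]-d, 0] the function is 1, and this history contributes ((t+d)^(1-a) - t^(1-a)) / (1-a):
    exactly what replaces the forcing at [t] by the forcing at [t + d]. *)
Lemma abel_mlf_shift_history d t : 0 <= d -> 0 < t ->
  abel a f (- d) t = (t + d) `^ (1 - a) / (1 - a) - G * F t.
Proof.
move=> d0 t0; rewrite /abel (@Rintegral_itv_split _ _ _ 0); first last.
- by apply: (@integrable_ppow_subM _ _ _ _ _ 1) => // [|s _]; [exact: measurable_funTS|exact: mlf_bound1].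
- by rewrite oppr_le0 d0 ltW.
rewrite -/(abel a f 0 t) abel_mlfE//.
have -> : \int[mu]_(s in `]- d, 0]) (ppow (- a) (t - s) * f s) = \int[mu]_(s in `]- d, 0]) ppow (- a) (t - s).
  apply: eq_Rintegral => s; rewrite inE/= in_itv/= => /andP[_ s0].
  by rewrite mlf_le0// mulr1.
have := @Rintegral_itv_split _ (fun s => ppow (- a) (t - s)) (- d) 0 t.
rewrite !Rintegral_ppow_sub// subr0 opprK (addrC (- a)) !ppow_powR ?ltr_wpDr//.
rewrite oppr_le0 d0 ltW// => /(_ isT (integrable_ppow_sub _ _ aN1)); lra.
Qed.

(** By translation this is the Abel equation at time [t + d]; its forcing is the one of the
    preceding lemma. *)
Lemma abel_mlf_shift d t : 0 <= d -> 0 < t ->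
  abel a (fun s => f (s + d)) (- d) t = (t + d) `^ (1 - a) / (1 - a) - G * F (t + d).
Proof.
move=> d0 t0; pose h v := ppow (- a) (t + d - v) * f v.
have mh : measurable_fun [set: R] h.
  by apply: measurable_funM => //; exact: measurable_ppow_sub.
have h0 v : 0 <= h v by rewrite mulr_ge0 ?ppow_ge0 ?mlf_ge0.
have td : 0 < t + d by rewrite ltr_wpDr.
rewrite -(abel_mlfE td) /abel.
transitivity (\int[mu]_(s in `]- d, t]) h (s + d)).
  2: by rewrite (ge0_Rintegral_shift (- d) t d mh h0) addNr.
apply: eq_Rintegral => s _.
by rewrite /h (_ : t + d - (s + d) = t - s)//; ring.
Qed.

Lemma mlf_nincr s t : s <= t -> f t <= f s.
Proof.
move=> st; pose d := t - s; pose u x := f x - f (x + d).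
have d0 : 0 <= d by rewrite subr_ge0.
suff : 0 <= u s by rewrite /u /d (_ : s + (t - s) = t) ?subr_ge0//; ring.
have [s0|s0] := leP s 0; first by rewrite /u mlf_le0// subr_ge0 mlf_le1.
rewrite leNgt; apply/negP => us.
have cfd : continuous (fun x => f (x + d)).
  move=> x; apply: (@continuous_comp _ _ _ (fun x => x + d) f); last exact: cf.
  by apply: cvgD; [exact: cvg_id|exact: cvg_cst].
have cu : continuous u by move=> x; apply: cvgB; [exact: cf|exact: cfd].
have [|c [c0 uc umin]] := min_on cu s0 us; first by rewrite /u mlf_le0// subr_ge0 mlf_le1.
have [M HM] := continuous_itv_bounded (- d) c cu.
have d0' : - d <= 0 by rewrite oppr_le0.
suff : 0 <= u c by rewrite leNgt uc.
apply: (@abel_minimum_principle _ a a0 a1 G u (- d) 0 c M abel_const_gt0 d0' c0 (continuous_measurable_fun cu) HM) => //.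
(* On the history ]-d, 0], u = 1 - f(x + d) is nonnegative, so the minimum over [0, c] is one over
   the whole of ]-d, c]. *)
- move=> x /andP[_ xc]; have [x0|x0] := leP x 0; last by apply: umin; rewrite xc ltW.
  by rewrite (le_trans (ltW uc))// /u mlf_le0// subr_ge0 mlf_le1.
- apply: derivableB; first exact: derivable_mlf.
  have cd : 0 < c + d by rewrite ltr_wpDr.
  have h1 : is_derive (c + d) 1 f (f^`()%classic (c + d)).
    by rewrite derive1E; apply: DeriveDef => //; exact: derivable_mlf.
  have h2 : is_derive c 1 (fun x => x + d) 1 by exact: is_derive_shift.
  by case: (@is_derive1_comp _ f (fun x => x + d) _ _ _ h1 h2).
(* The forcings cancel, and the increments of this Abel integral equal -G times the integral of u:
   the minimum principle applies with equality. *)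
- have E x : 0 < x -> abel a u (- d) x = G * (F (x + d) - F x).
    move=> x0; rewrite /abel.
    transitivity (\int[mu]_(v in `]- d, x]) (ppow (- a) (x - v) * f v - ppow (- a) (x - v) * f (v + d))).
      by apply: eq_Rintegral => v _; rewrite /u mulrBr.
    rewrite RintegralB//; first last.
    + apply: (@integrable_ppow_subM _ _ _ _ _ 1) => //; last by move=> v _; exact: mlf_bound1.
      by apply: measurable_funTS; exact: continuous_measurable_fun.
    + apply: (@integrable_ppow_subM _ _ _ _ _ 1) => //; last by move=> v _; exact: mlf_bound1.
      exact: measurable_funTS.
    rewrite -/(abel a f (- d) x) -/(abel a (fun s => f (s + d)) (- d) x).
    by rewrite abel_mlf_shift_history// abel_mlf_shift//; ring.
  move=> x /andP[x0 xc]; rewrite !E// -mulrBr.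
  have -> : \int[mu]_(v in `]x, c]) u v = (F c - F x) - (F (c + d) - F (x + d)).
    rewrite /u RintegralB//; last exact: integrable_continuous_itv.
    rewrite (ge0_Rintegral_shift x c d mf mlf_ge0).
    rewrite -!mlf_primitiveB//; first by rewrite lerD2r (ltW xc) addr_ge0// ltW.
    by rewrite !ltW.
  rewrite mulNr -mulrN ler_pM2l ?abel_const_gt0//; lra.
Qed.

End mlf_monotone.

(** * Asymptotics *)

Section monotone_density.
Context {R : realType}.
Implicit Types p t s e : R.

Lemma cvgy_powRN p : 0 < p -> t `^ (- p) @[t --> +oo] --> 0.
Proof.
move=> p0; apply/cvgrPdist_le => e e0; near=> t.
have e1 : 0 < e `^ (- p^-1) by rewrite powR_gt0.
have te : e `^ (- p^-1) <= t by near: t; apply: nbhs_pinfty_ge; exact: num_real.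
have t0 := lt_le_trans e1 te.
rewrite sub0r normrN ger0_norm ?powR_ge0// powRN -[leRHS]invrK lef_pV2 ?posrE ?invr_gt0 ?powR_gt0//.
have -> : e^-1 = (e `^ (- p^-1)) `^ p.
  by rewrite -powRrM mulNr mulVf ?gt_eqF// powR_inv1// ltW.
by apply: ge0_ler_powR; rewrite ?nnegrE// ltW.
Unshelve. all: by end_near. Qed.

(** The derivative of x^p at 1 is p; a common step below 1 serves both one-sided quotients and keeps
    1 - h positive. *)
Lemma powR_difference_quotient p e : 0 < e -> exists h,
  [/\ 0 < h, h < 1, `|(1 - (1 - h) `^ p) / h - p| <= e &
   `|((1 + h) `^ p - 1) / h - p| <= e].
Proof.
move=> e0; have [dp vp] := is_derive1_powR p (@ltr01 R).
have : h^-1 *: (((@powR R)^~ p \o shift 1) (h *: (1 : R)) - 1 `^ p) @[h --> 0^'] --> p.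
  have pE : p = 'D_1 ((@powR R)^~ p) 1 by rewrite vp powR1 mulr1.
  by rewrite [X in _ --> X]pE; exact: dp.
move=> /cvgrPdist_le/(_ e e0); rewrite /dnbhs/= near_withinE => /nbhs_ballP[r/= r0 H].
have [h [h0 hr h1]] : exists h, [/\ 0 < h, h < r & h < 1].
  exists (Num.min r 1 / 2); have : Num.min r 1 <= r by rewrite ge_min lexx.
  have : Num.min r 1 <= 1 by rewrite ge_min lexx orbT.
  have : 0 < Num.min r 1 by rewrite lt_min r0 ltr01.
  by move=> *; split; lra.
exists h; split => //.
- have := H (- h); rewrite /ball/= sub0r opprK gtr0_norm// => /(_ hr).
  rewrite oppr_eq0 gt_eqF// => /(_ isT).
  rewrite distrC /GRing.scale/= mulr1 powR1 (addrC (- h)) invrN mulNr -mulrN opprB.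
  by rewrite mulrC.
- have := H h; rewrite /ball/= sub0r normrN gtr0_norm// => /(_ hr).
  rewrite gt_eqF// => /(_ isT).
  by rewrite distrC /GRing.scale/= mulr1 powR1 (addrC h) mulrC.
Qed.

(** The monotone density theorem. The value f(t) is squeezed between the difference quotients of F
    over [t, (1+h) t] and [(1-h) t, t], which after rescaling are close to those of A x^p at 1,
    hence to A p. *)
Lemma monotone_density (f F : R -> R) (A p : R) :
  (forall s t, 0 < s <= t -> f t * (t - s) <= F t - F s <= f s * (t - s)) ->
  F t / t `^ p @[t --> +oo] --> A ->
  f t * t `^ (1 - p) @[t --> +oo] --> A * p.
Proof.
move=> fF FA; apply/cvgrPdist_le => e e0.
have A1 : 0 < `|A| + 1 by rewrite ltr_wpDl.
have [h [h0 h1 hm hp]] : exists h, [/\ 0 < h, h < 1,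
    `|(1 - (1 - h) `^ p) / h - p| <= e / 2 / (`|A| + 1) &
    `|((1 + h) `^ p - 1) / h - p| <= e / 2 / (`|A| + 1)].
  by apply: powR_difference_quotient; rewrite !divr_gt0.
set q := (1 - h) `^ p in hm; set q' := (1 + h) `^ p in hp.
have q0 : 0 <= q by exact: powR_ge0.
have q'0 : 0 <= q' by exact: powR_ge0.
(* The errors on the values of F at (1-h) t, t and (1+h) t have weights q, 1 and q'; this [d] makes
   their sum h e/2, so e/2 after division by h. The other e/2 pays for the difference quotients. *)
pose d := h * (e / 2) / (1 + q + q').
have Q0 : 0 < 1 + q + q' by lra.
have d0 : 0 < d by rewrite /d divr_gt0// mulr_gt0// divr_gt0.
have [T [_ HT]] : exists T, T \is Num.real /\ forall t, T < t -> `|A - F t / t `^ p| <= d.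
  by move/cvgrPdist_le : FA => /(_ _ d0).
near=> t.
have tT : `|T| / (1 - h) < t by near: t; apply: nbhs_pinfty_gt; exact: num_real.
have h1' : 0 < 1 - h by lra.
have t0 : 0 < t by apply: le_lt_trans tT; rewrite divr_ge0// ltW.
have T1 : T < (1 - h) * t.
  by rewrite mulrC -ltr_pdivrMr//; apply: le_lt_trans tT; rewrite ler_pM2r ?invr_gt0// ler_norm.
have ht0 : 0 < h * t by rewrite mulr_gt0.
have T2 : T < t by lra.
have T3 : T < (1 + h) * t by lra.
have s1 : 0 < (1 - h) * t by rewrite mulr_gt0.
have s3 : 0 < (1 + h) * t by lra.
have tp : 0 < t `^ p by rewrite powR_gt0.
have Fq (c : R) : 0 < c -> F (c * t) = F (c * t) / (c * t) `^ p * (c `^ p * t `^ p).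
  by move=> c0; rewrite powRM ?ltW// mulfVK// gt_eqF// mulr_gt0// powR_gt0.
have := fF ((1 - h) * t) t; rewrite s1/= ler_piMl ?(ltW t0)//; last by lra.
move=> /(_ isT) /andP[up _].
have := fF t ((1 + h) * t); rewrite t0/= ler_peMl ?(ltW t0)//; last by lra.
move=> /(_ isT) /andP[_ lo].
move: up lo; rewrite (Fq (1 - h))// (Fq (1 + h)) -/q -/q'; last by lra.
have -> : F t = F t / t `^ p * t `^ p by rewrite mulfVK// gt_eqF.
set y1 := F ((1 - h) * t) / _; set y3 := F ((1 + h) * t) / _; set y2 := F t / _.
have E : t = t `^ (1 - p) * t `^ p.
  by rewrite -powRD ?subrK ?powRr1 ?(ltW t0)// (gt_eqF t0) implybT.
pose v := f t * t `^ (1 - p).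
have -> : f t * (t - (1 - h) * t) = h * v * t `^ p by rewrite {2 3}E /v; ring.
have -> : f t * ((1 + h) * t - t) = h * v * t `^ p by rewrite {2 3}E /v; ring.
have -> : y2 * t `^ p - y1 * (q * t `^ p) = (y2 - q * y1) * t `^ p by ring.
have -> : y3 * (q' * t `^ p) - y2 * t `^ p = (q' * y3 - y2) * t `^ p by ring.
rewrite !ler_pM2r// => up lo.
move: (HT _ T3) (HT _ T2) (HT _ T1); rewrite -/y1 -/y2 -/y3 !ler_distlC => /andP[a3 b3] /andP[a2 b2] /andP[a1 b1].
rewrite -/v.
pose r := (1 - q) / h; pose r' := (q' - 1) / h.
have Er : 1 - q = h * r by rewrite /r; field; rewrite gt_eqF.
have Er' : q' - 1 = h * r' by rewrite /r'; field; rewrite gt_eqF.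
have dh : d * (1 + q + q') = h * (e / 2) by rewrite /d mulfVK// gt_eqF.
have AR x : `|x - p| <= e / 2 / (`|A| + 1) -> `|A * (x - p)| <= e / 2.
  move=> hx; rewrite normrM; apply: (@le_trans _ _ ((`|A| + 1) * `|x - p|)).
    by rewrite ler_wpM2r// lerDl.
  by rewrite mulrC -ler_pdivlMr.
have /AR : `|r - p| <= e / 2 / (`|A| + 1) by exact: hm.
have /AR : `|r' - p| <= e / 2 / (`|A| + 1) by exact: hp.
rewrite !ler_norml => /andP[m1 _] /andP[_ m2].
have U : v <= A * r + e / 2.
  rewrite -(ler_pM2l h0); apply: le_trans up _.
  have : q * (A - d) <= q * y1 by apply: ler_wpM2l => //; lra.
  have : 0 <= d * q' by rewrite mulr_ge0// (ltW d0).
  have : h * (A * r + e / 2) = A * (1 - q) + d * (1 + q + q') by rewrite Er dh; ring.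
  move=> ->; lra.
have L : A * r' - e / 2 <= v.
  rewrite -(ler_pM2l h0); apply: le_trans lo.
  have : q' * (A - d) <= q' * y3 by apply: ler_wpM2l => //; lra.
  have : 0 <= d * q by rewrite mulr_ge0// (ltW d0).
  have : h * (A * r' - e / 2) = A * (q' - 1) - d * (1 + q + q') by rewrite Er' dh; ring.
  move=> ->; lra.
lra.
Unshelve. all: by end_near. Qed.

End monotone_density.

(** * Power decay of the Mittag-Leffler function *)

Section mlf_asymptotics.
Context {R : realType}.
Variables (a g : R).
Hypotheses (a0 : 0 < a) (a1 : a < 1) (g0 : 0 < g).
Implicit Types s t x : R.
Local Notation mu := (@lebesgue_measure R).
Local Notation f := (mlf a g).
Local Notation F := (mlf_primitive a g).
Local Notation G := (abel_const a g).

Let aN1 : -1 < - a. Proof. by rewrite ltrN2. Qed.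
Let p0 : 0 < 1 - a. Proof. by rewrite subr_gt0. Qed.
Let G0 : 0 < G. Proof. exact: abel_const_gt0. Qed.
Let cf : continuous f. Proof. exact: continuous_mlf. Qed.
Let mf : measurable_fun [set: R] f. Proof. exact: continuous_measurable_fun. Qed.
Let if_ b t : mu.-integrable `]b, t] (EFin \o f). Proof. exact: integrable_continuous_itv. Qed.

(** The constant left in the Abel equation when its left-hand side is dropped; it serves both as a
    bound for F(t) / t^(1-a) and as its limit. *)
Definition mlf_bound : R := ((1 - a) * G)^-1.
Local Notation A := mlf_bound.

Lemma mlf_bound_gt0 : 0 < A.
Proof. by rewrite invr_gt0 mulr_gt0. Qed.

Lemma mlf_primitive_increment s t : 0 <= s <= t ->
  f t * (t - s) <= F t - F s <= f s * (t - s).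
Proof.
move=> st; have /andP[s0 st'] := st; rewrite mlf_primitiveB// -!Rintegral_cst_itv//.
by apply/andP; split; apply: le_Rintegral => //;
  try (exact/integrable_continuous_itv/cst_continuous);
  move=> v /=; rewrite in_itv/= => /andP[sv vt]; apply: mlf_nincr => //; exact: ltW.
Qed.

Lemma mlf_primitive_le t : 0 < t -> F t <= A * t `^ (1 - a).
Proof.
move=> t0; have : 0 <= abel a f 0 t.
  by apply: Rintegral_ge0 => s _; rewrite mulr_ge0 ?ppow_ge0 ?mlf_ge0.
rewrite abel_mlfE// subr_ge0 ler_pdivlMr// => h.
rewrite /A ler_pdivlMl; last exact: mulr_gt0.
by apply: le_trans h; lra.
Qed.

(** Monotonicity gives t f(t) <= F(t). *)
Lemma mlf_le_powR t : 0 < t -> f t <= A * t `^ (- a).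
Proof.
move=> t0; rewrite -(ler_pM2r t0); apply: (@le_trans _ _ (F t)).
  have /mlf_primitive_increment : 0 <= (0 : R) <= t by rewrite lexx ltW.
  by rewrite /mlf_primitive set_itvoc0// Rintegral_set0 !subr0 => /andP[].
apply: le_trans (mlf_primitive_le t0) _.
rewrite -mulrA ler_pM2l ?mlf_bound_gt0//.
rewrite -[X in _ <= _ * X](powRr1 (ltW t0)) -powRD ?(gt_eqF t0) ?implybT//.
by rewrite (addrC (- a)).
Qed.

(** Cut at the midpoint: on ]0, x] the kernel is at most x^(-a) and f has integral at most A
    x^(1-a); on ]x, 2x] f is at most A x^(-a) and the kernel has integral x^(1-a) / (1-a). The gain
    over x^(1-a) is the factor x^(-a). *)
Lemma abel_mlf_le x : 0 < x ->
  abel a f 0 (x + x) <= A * (1 + (1 - a)^-1) * (x `^ (- a) * x `^ (1 - a)).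
Proof.
move=> x0; have xx : 0 < x + x by rewrite addr_gt0.
have i1 : mu.-integrable `]0, (x + x)] (EFin \o (fun s => ppow (- a) (x + x - s) * f s)).
  apply: (@integrable_ppow_subM _ _ _ _ _ 1) => // [|s _]; first exact: measurable_funTS.
  exact: mlf_bound1.
have s1 : `]0, x] `<=` `]0, (x + x)]%classic by apply: subset_itvl; rewrite bnd_simp lerDl ltW.
have s2 : `]x, (x + x)] `<=` `]0, (x + x)]%classic by apply: subset_itvr; rewrite bnd_simp ltW.
rewrite /abel (@Rintegral_itv_split _ _ 0 x)//; last by rewrite ltW//= lerDl ltW.
have xa : 0 <= x `^ (- a) by exact: powR_ge0.
have h1 : \int[mu]_(s in `]0, x]) (ppow (- a) (x + x - s) * f s) <= x `^ (- a) * (A * x `^ (1 - a)).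
  apply: (@le_trans _ _ (\int[mu]_(s in `]0, x]) (x `^ (- a) * f s))).
    apply: le_Rintegral => //.
    - exact: integrableS i1.
    - rewrite (_ : EFin \o _ = (fun s => (x `^ (- a))%:E * (EFin \o f) s)%E).
        by apply: integrableZl.
      by apply/funext => s; rewrite /= EFinM.
    move=> s /=; rewrite in_itv/= => /andP[s0 sx].
    rewrite ler_wpM2r ?mlf_ge0// ppow_powR; last by lra.
    rewrite !powRN lef_pV2 ?posrE ?powR_gt0//; last by lra.
    by apply: ge0_ler_powR; rewrite ?nnegrE ?(ltW a0) ?(ltW x0)//; lra.
  rewrite RintegralZl// ler_wpM2l//; exact: mlf_primitive_le.
have h2 : \int[mu]_(s in `]x, (x + x)]) (ppow (- a) (x + x - s) * f s) <=
    x `^ (1 - a) / (1 - a) * (A * x `^ (- a)).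
  apply: (@le_trans _ _ (\int[mu]_(s in `]x, (x + x)]) (ppow (- a) (x + x - s) * f x))).
    apply: le_Rintegral => //.
    - exact: integrableS i1.
    - rewrite (_ : EFin \o _ = (fun s => (ppow (- a) (x + x - s))%:E * (f x)%:E)%E).
        by apply: integrableZr => //; exact: integrable_ppow_sub.
      by apply/funext => s; rewrite /= EFinM.
    move=> s /=; rewrite in_itv/= => /andP[xs _].
    by rewrite ler_wpM2l ?ppow_ge0// mlf_nincr// ltW.
  rewrite RintegralZr//; last exact: integrable_ppow_sub.
  rewrite Rintegral_ppow_sub// addrK (addrC (- a)) ppow_powR//.
  by apply: ler_wpM2l (mlf_le_powR x0); rewrite divr_ge0 ?powR_ge0// ltW.
apply: le_trans (lerD h1 h2) _; rewrite le_eqVlt; apply/orP; left; apply/eqP; ring.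
Qed.

Lemma cvg_mlf_primitive : F t / t `^ (1 - a) @[t --> +oo] --> A.
Proof.
apply/cvgrPdist_le => e e0.
(* By the Abel equation the error is the Abel integral divided by G t^(1-a); with t = 2x the
   midpoint bound makes it at most B x^(-a). *)
pose B := A * (1 + (1 - a)^-1) / G.
have B0 : 0 < B by rewrite divr_gt0// mulr_gt0 ?mlf_bound_gt0// addr_gt0// invr_gt0.
have /cvgr0Pnorm_le/(_ _ (divr_gt0 e0 B0)) [T [_ HT]] := cvgy_powRN a0.
near=> t.
have t0 : 0 < t by near: t; exact: nbhs_pinfty_gt.
have tT : T + T < t by near: t; apply: nbhs_pinfty_gt; exact: num_real.
pose x := t / 2; have x0 : 0 < x by rewrite /x; lra.
have tE : t = x + x by rewrite /x; field.
have xT : T < x by rewrite /x; lra.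
have tp : 0 < t `^ (1 - a) by rewrite powR_gt0.
have E : A - F t / t `^ (1 - a) = abel a f 0 t / G / t `^ (1 - a).
  rewrite abel_mlfE// /A; field.
  by rewrite !gt_eqF.
have ab0 : 0 <= abel a f 0 t.
  by apply: Rintegral_ge0 => s _; rewrite mulr_ge0 ?ppow_ge0 ?mlf_ge0.
rewrite E ger0_norm ?divr_ge0 ?(ltW G0) ?(ltW tp)// ler_pdivrMr//.
apply: (@le_trans _ _ (B * (x `^ (- a) * x `^ (1 - a)))).
  by rewrite /B mulrAC ler_pM2r ?invr_gt0// tE abel_mlf_le.
rewrite mulrA; apply: ler_pM; rewrite ?powR_ge0//.
- by rewrite mulr_ge0 ?powR_ge0// ltW.
- by have := HT _ xT; rewrite ger0_norm ?powR_ge0// ler_pdivlMr// mulrC.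
by apply: ge0_ler_powR; rewrite ?nnegrE ?(ltW p0) ?(ltW x0) ?(ltW t0)// tE lerDl ltW.
Unshelve. all: by end_near. Qed.

Lemma mlf_asymptotics : f t / (G^-1 * t `^ (- a)) @[t --> +oo] --> (1 : R).
Proof.
have inc s t : 0 < s <= t -> f t * (t - s) <= F t - F s <= f s * (t - s).
  by move=> /andP[s0 st]; apply: mlf_primitive_increment; rewrite ltW.
have := monotone_density inc cvg_mlf_primitive.
rewrite (_ : A * (1 - a) = G^-1); last by rewrite /A; field; rewrite !gt_eqF.
rewrite (_ : 1 - (1 - a) = a); last by ring.
move=> /(@cvgMr _ _ _ _ _ G); rewrite mulfV ?gt_eqF//.
rewrite (_ : (fun t => _) = (fun t => f t / (G^-1 * t `^ (- a))))//.
by apply/funext => t; rewrite powRN invfM !invrK; ring.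
Qed.

End mlf_asymptotics.

(** * Fourier integrals of nonincreasing functions *)

Section oscillatory.
Context {R : realType}.
Local Notation mu := (@lebesgue_measure R).

Lemma integrable_continuous_itvcc (u : R -> R) (b t : R) : continuous u ->
  mu.-integrable `[b, t] (EFin \o u).
Proof.
move=> cu; apply: continuous_compact_integrable; first exact: segment_compact.
exact: continuous_subspaceT.
Qed.

Lemma Rintegral_itvcc_split (h : R -> R) (x y z : R) : continuous h -> x <= y <= z ->
  \int[mu]_(s in `[x, z]) h s = \int[mu]_(s in `[x, y]) h s + \int[mu]_(s in `[y, z]) h s.
Proof.
move=> ch /andP[xy yz].
rewrite -(@Rintegral_itv_obnd_cbnd _ y); last first.
  by apply: integrableS (integrable_continuous_itvcc y z ch) => //; exact: subset_itv_oc_cc.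
rewrite -(@Rintegral_itvB _ h (BLeft x)) ?bnd_simp//; first by rewrite addrC subrK.
exact: integrable_continuous_itvcc.
Qed.

Lemma nonincreasing_derive_le0 (f : R -> R) (x : R) :
  {homo f : s t / s <= t >-> t <= s} -> derivable f x 1 -> 'D_1 f x <= 0.
Proof.
move=> fn df; apply: limr_le => //; apply: nearW => h.
rewrite /GRing.scale/= mulr1; have [h0|h0|->] := ltgtP h 0.
- by rewrite nmulr_rle0 ?invr_lt0// subr_ge0 fn// gerDr ltW.
- by rewrite pmulr_rle0 ?invr_gt0// subr_le0 fn// lerDr ltW.
- by rewrite invr0 mul0r.
Qed.

Variables (f : R -> R).
Hypotheses (cf : continuous f) (f0 : forall s, 0 <= f s)
  (fn : {homo f : s t / s <= t >-> t <= s})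
  (df : forall s, 0 < s -> derivable f s 1).

(* Integration by parts without integrating [f']: the two functions
   [\int k f - S f +- M f] have derivatives [(+- M - S) f'], of constant sign. *)
Lemma oscillatory_integral_le (k S : R -> R) (M A B : R) :
  0 <= A -> A < B -> continuous k ->
  (forall s : R, is_derive s 1 S (k s)) -> (forall s, `|S s| <= M) ->
  `|\int[mu]_(s in `[A, B]) (k s * f s)| <= 2 * M * f A.
Proof.
move=> A0 AB ck dS SM.
have ckf : continuous (fun s => k s * f s) by move=> s; apply: cvgM; [exact: ck|exact: cf].
have ikf b t := integrable_continuous_itvcc b t ckf.
pose I t := \int[mu]_(s in `[A, t]) (k s * f s).
have cS : continuous S by move=> s; exact: is_derive1_cvg (dS s).
pose Phi (e t : R) := I t - S t * f t + e * (M * f t).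
have dPhi e t : t \in `]A, B[ -> is_derive t 1 (Phi e) ((e * M - S t) * 'D_1 f t).
  rewrite in_itv/= => /andP[At tB].
  have [dI vI] := continuous_FTC1_closed (ltr_pwDr ltr01 (lexx t)) (ikf A (t + 1)) At (ckf t).
  have hI : is_derive t 1 I (k t * f t) by apply: DeriveDef => //; rewrite -derive1E.
  have hf : is_derive t 1 f ('D_1 f t) by apply: DeriveDef => //; apply: df; exact: le_lt_trans At.
  have hS := dS t.
  have h1 := is_deriveB hI (is_deriveM hS hf).
  have h2 := is_deriveD h1 (is_deriveZ e (is_deriveZ M hf)).
  by apply: is_derive_eq h2 _; rewrite /GRing.scale/=; ring.
have cPhi e : {within `[A, B], continuous (Phi e)}.
  have cI := parameterized_integral_continuous (ltW AB) (ikf A B).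
  move=> t; apply: cvgD; first apply: cvgB; first exact: cI.
  - by apply: (continuous_subspaceT (fun s => @cvgM _ _ _ _ _ _ _ _ (cS s) (@cf s))).
  - apply: cvgMr; apply: cvgMr; exact: (continuous_subspaceT cf).
have D0 t : t \in `]A, B[ -> 'D_1 f t <= 0.
  rewrite in_itv/= => /andP[At tB]; apply: nonincreasing_derive_le0 => //.
  by apply: df; exact: le_lt_trans At.
have SM' t : - M <= S t <= M by rewrite -ler_norml.
have AA : A \in `[A, B] by rewrite in_itv/= lexx ltW.
have BB : B \in `[A, B] by rewrite in_itv/= lexx ltW.
have P1 : Phi 1 B <= Phi 1 A.
  apply: (@ler0_derive1_le_cc _ (Phi 1) A B) => //; last exact: ltW.
  - by move=> t /(dPhi 1) [].
  - move=> t tAB; rewrite derive1E; have [_ ->] := dPhi 1 t tAB.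
    by rewrite mulr_ge0_le0 ?D0// mul1r subr_ge0; case/andP: (SM' t).
have P2 : Phi (-1) A <= Phi (-1) B.
  apply: (@ger0_derive1_le_cc _ (Phi (-1)) A B) => //; last exact: ltW.
  - by move=> t /(dPhi (-1)) [].
  - move=> t tAB; rewrite derive1E; have [_ ->] := dPhi (-1) t tAB.
    by rewrite mulr_le0 ?D0// mulN1r subr_le0; case/andP: (SM' t).
have IA : I A = 0 by rewrite /I set_itv1 Rintegral_set1.
move: P1 P2; rewrite /Phi IA -/(I B) !mulN1r !mul1r => P1 P2.
have [SA1 SA2] := andP (SM' A); have [SB1 SB2] := andP (SM' B).
(* The terms at the right endpoint have a favourable sign because |S| <= M and f >= 0; those at [A]
   add up to at most 2 M f(A). *)
have a1 : - M * f A <= S A * f A by rewrite ler_wpM2r.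
have a2 : S A * f A <= M * f A by rewrite ler_wpM2r.
have b1 : - M * f B <= S B * f B by rewrite ler_wpM2r.
have b2 : S B * f B <= M * f B by rewrite ler_wpM2r.
rewrite ler_norml; lra.
Qed.

Hypothesis fcvg0 : f s @[s --> +oo] --> 0.

(** The tail bound with f -> 0 gives the Cauchy criterion. The cut [A] is left free, so that
    oscillation is exploited only beyond a point chosen according to the frequency. *)
Lemma cvg_oscillatory_integral (k S : R -> R) (M A : R) :
  0 < A -> continuous k ->
  (forall s : R, is_derive s 1 S (k s)) -> (forall s, `|S s| <= M) ->
  exists2 l, \int[mu]_(s in `[0, t]) (k s * f s) @[t --> +oo] --> l &
    `|l| <= `|\int[mu]_(s in `[0, A]) (k s * f s)| + 2 * M * f A.
Proof.
move=> A0 ck dS SM.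
have M0 : 0 <= M by apply: le_trans (SM 0).
have ckf : continuous (fun s => k s * f s) by move=> s; apply: cvgM; [exact: ck|exact: cf].
pose I t := \int[mu]_(s in `[0, t]) (k s * f s).
have IB x y : 0 <= x -> x < y -> `|I y - I x| <= 2 * M * f x.
  move=> x0 xy; rewrite /I (@Rintegral_itvcc_split _ 0 x y)//; last by rewrite x0 ltW.
  by rewrite addrAC subrr add0r; exact: oscillatory_integral_le dS SM.
have cI : cvg (I t @[t --> +oo]).
  apply: cauchy_cvg; apply: cauchy_exP => e e0.
  have [T [T0 HT]] : exists T, 0 <= T /\ 2 * M * f T < e.
    have e1 : 0 < e / (2 * M + 1) by rewrite divr_gt0// ltr_wpDl// mulr_ge0.
    have : \forall t \near +oo, 0 <= t /\ `|f t| < e / (2 * M + 1).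
      near=> t; split; first by near: t; exact: nbhs_pinfty_ge.
      by near: t; exact: (cvgr0_norm_lt _ fcvg0).
    move=> /(@filter_ex _ +oo)[T [T0 HT]]; exists T; split => //.
    move: HT; rewrite ger0_norm// ltr_pdivlMr; last by rewrite ltr_wpDl// mulr_ge0.
    by apply: le_lt_trans; rewrite mulrC ler_wpM2l// lerDl.
  exists (I T); suff : \forall t \near +oo, ball (I T) e (I t) by [].
  near=> t; rewrite /ball/= distrC; apply: le_lt_trans HT.
  by apply: IB => //; near: t; apply: nbhs_pinfty_gt; exact: num_real.
exists (lim (I t @[t --> +oo])); first exact: cI.
have nI : `|I t| @[t --> +oo] --> `|lim (I t @[t --> +oo])| by exact: cvg_norm.
rewrite -(cvg_lim _ nI)//; apply: limr_le; first by apply/cvg_ex; eexists; exact: nI.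
near=> t; have -> : I t = I A + (I t - I A) by ring.
apply: le_trans (ler_normD _ _) _; rewrite lerD2l; apply: IB; first exact: ltW.
by near: t; apply: nbhs_pinfty_gt; exact: num_real.
Unshelve. all: by end_near. Qed.

End oscillatory.

Lemma Rintegral_oppr (R : realType) (h : R -> R) (x : R) : continuous h -> x <= 0 ->
  \int[lebesgue_measure]_(s in `[x, 0]) h s =
  \int[lebesgue_measure]_(s in `[0, (- x)]) h (- s).
Proof.
move=> ch x0; have := @integration_by_substitution_oppr _ h 0 (- x).
rewrite oppr_ge0 opprK oppr0 => /(_ x0 (continuous_subspaceT ch)) E.
by rewrite /Rintegral E.
Qed.

(** * Fourier integrals of the Mittag-Leffler function *)

Section mlf_fourier.
Context {R : realType}.
Variables (a g : R).
Hypotheses (a0 : 0 < a) (a1 : a < 1) (g0 : 0 < g).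
Local Notation mu := (@lebesgue_measure R).
Local Notation f := (mlf a g).
Local Notation A := (mlf_bound a g).

Let cf : continuous f. Proof. exact: continuous_mlf. Qed.

Lemma cvg_mlf0 : f s @[s --> +oo] --> 0.
Proof.
have h : A * s `^ (- a) @[s --> +oo] --> 0.
  by rewrite -[X in _ --> X](mulr0 A); apply: cvgMr; exact: cvgy_powRN.
have h0 : (fun _ : R => 0 : R) @ +oo --> (0 : R) by exact: cvg_cst.
have nf : \forall s \near +oo, (0 : R) <= f s <= A * s `^ (- a).
  near=> s; have s0 : 0 < s by near: s; exact: nbhs_pinfty_gt.
  by rewrite mlf_ge0//= mlf_le_powR.
exact: (squeeze_cvgr nf h0 h).
Unshelve. all: by end_near. Qed.

Lemma mlf_oscillatory_integral (k S : R -> R) (c w : R) :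
  w != 0 -> continuous k -> (forall s : R, is_derive s 1 S (k s)) ->
  (forall s, `|k s| <= c) -> (forall s, `|S s| <= c / `|w|) ->
  exists2 l, \int[mu]_(s in `[0, t]) (k s * f s) @[t --> +oo] --> l &
    `|l| <= 3 * c * A * `|w| `^ (a - 1).
Proof.
move=> w0 ck dS kc Sc; have nw : 0 < `|w| by rewrite normr_gt0.
(* At this cut c A x^(1-a) bounds the part over [0, x], and 2 (c / |w|) f(x) <= 2 c A x^(1-a) the
   rest: hence the constant 3. *)
pose x := `|w|^-1; have x0 : 0 < x by rewrite invr_gt0.
have c0 : 0 <= c by apply: le_trans (kc 0).
have fn : {homo f : s t / s <= t >-> t <= s} by move=> s t; exact: mlf_nincr.
have f0 s : 0 <= f s by exact: mlf_ge0.
have df s : 0 < s -> derivable f s 1 by exact: derivable_mlf.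
have [l hl ll] := cvg_oscillatory_integral cf f0 fn df cvg_mlf0 x0 ck dS Sc.
exists l => //; apply: le_trans ll _.
have xE : x `^ (1 - a) = `|w| `^ (a - 1).
  by rewrite /x -powR_inv1 ?(ltW nw)// -powRrM; congr (_ `^ _); ring.
have xE' : x * x `^ (- a) = x `^ (1 - a).
  by rewrite -{1}(powRr1 (ltW x0)) -powRD// (gt_eqF x0) implybT.
have h1 : `|\int[mu]_(s in `[0, x]) (k s * f s)| <= c * (A * x `^ (1 - a)).
  have ickf : mu.-integrable `[0, x] (EFin \o (fun s => k s * f s)).
    by apply: integrable_continuous_itvcc => s; apply: cvgM; [exact: ck|exact: cf].
  apply: le_trans (le_normr_Rintegral _ ickf) _ => //.
  apply: (@le_trans _ _ (\int[mu]_(s in `[0, x]) (c * f s))).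
    apply: le_Rintegral => //.
    - by apply: integrable_continuous_itvcc => s; apply: cvg_norm; apply: cvgM; [exact: ck|exact: cf].
    - by apply: integrable_continuous_itvcc => s; apply: cvgMr; exact: cf.
    - by move=> s _; rewrite normrM (ger0_norm (f0 s)) ler_wpM2r.
  rewrite RintegralZl//; last exact: integrable_continuous_itvcc.
  rewrite ler_wpM2l// -Rintegral_itv_obnd_cbnd; last exact: integrable_continuous_itv.
  exact: mlf_primitive_le.
have h2 : 2 * (c / `|w|) * f x <= 2 * c * (A * x `^ (1 - a)).
  rewrite -xE' -/x (_ : _ * (A * _) = 2 * (c * x) * (A * x `^ (- a))); last by ring.
  by apply: ler_wpM2l (mlf_le_powR a0 a1 g0 x0); rewrite mulr_ge0// mulr_ge0// ltW.
by apply: le_trans (lerD h1 h2) _; rewrite -xE le_eqVlt; apply/orP; left; apply/eqP; ring.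
Qed.

(** The negative half-line is reflected onto the positive one, with kernel k(-s) and primitive
    -S(-s), which obey the same bounds; the constant is 6 = 3 + 3. *)
Lemma improper_integral_mlf (k S : R -> R) (c w : R) :
  w != 0 -> continuous k -> (forall s : R, is_derive s 1 S (k s)) ->
  (forall s, `|k s| <= c) -> (forall s, `|S s| <= c / `|w|) ->
  improper_integrable (fun s => k s * f `|s|) /\
  `|improper_integral (fun s => k s * f `|s|)| <= 6 * c * A * `|w| `^ (a - 1).
Proof.
move=> w0 ck dS kc Sc; pose h s := k s * f `|s|.
have ch : continuous h.
  move=> s; apply: cvgM; first exact: ck.
  apply: (@continuous_comp _ _ _ (fun s : R => `|s|) f); last exact: cf.
  exact: norm_continuous.
have cN : continuous (fun s : R => - s) by move=> s; exact: oppr_continuous.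
have ckN : continuous (fun s => k (- s)).
  by move=> s; apply: (@continuous_comp _ _ _ (fun s : R => - s) k); [exact: cN|exact: ck].
have dSN (s : R) : is_derive s 1 (fun s => - S (- s)) (k (- s)).
  have hN : is_derive s 1 (fun s : R => - s) (-1) by exact: is_deriveN.
  have := is_deriveN (@is_derive1_comp _ S (fun s => - s) _ _ _ (dS (- s)) hN).
  by rewrite mulrN1 opprK.
have SNc s : `|- S (- s)| <= c / `|w| by rewrite normrN.
have [l1 hl1 ll1] := mlf_oscillatory_integral w0 ckN dSN (fun s => kc (- s)) SNc.
have [l2 hl2 ll2] := mlf_oscillatory_integral w0 ck dS kc Sc.
pose J t := \int[mu]_(s in `[0, t]) (k (- s) * f s).
pose I t := \int[mu]_(s in `[0, t]) (k s * f s).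
pose Phi (ab : R * R) := \int[mu]_(s in `[ab.1, ab.2]) h s.
(* The endpoints decouple once they lie on either side of 0, which reduces the limit along the
   product filter to two one-variable limits. *)
have PhiE (x y : R) : x <= 0 -> 0 <= y -> Phi (x, y) = J (- x) + I y.
  move=> x0 y0; have xy : x <= 0 <= y by rewrite x0 y0.
  have EJ : \int[mu]_(s in `[x, 0]) h s = J (- x).
    rewrite (Rintegral_oppr ch x0); apply: eq_Rintegral => s.
    by rewrite inE/= in_itv/= => /andP[s0 _]; rewrite /h normrN ger0_norm.
  have EI : \int[mu]_(s in `[0, y]) h s = I y.
    apply: eq_Rintegral => s; rewrite inE/= in_itv/= => /andP[s0 _].
    by rewrite /h ger0_norm.
  by rewrite -EJ -EI; exact: Rintegral_itvcc_split ch xy.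
have cPhi : Phi @ filter_prod -oo +oo --> l1 + l2.
  have c1 : (J \o -%R) (ab.1) @[ab --> filter_prod (-oo : set_system R) (+oo : set_system R)] --> l1.
    apply: (cvg_comp fst (J \o -%R)); first exact: cvg_fst.
    apply/cvgNy_compNP; rewrite (_ : _ \o _ = J)//.
    by apply/funext => t; rewrite /= opprK.
  have c2 : I (ab.2) @[ab --> filter_prod (-oo : set_system R) (+oo : set_system R)] --> l2.
    exact: (cvg_comp snd I (cvg_snd (F := -oo)) hl2).
  have c12 : (fun ab : R * R => (J \o -%R) ab.1 + I ab.2) @ filter_prod (-oo : set_system R) (+oo : set_system R) --> (l1 + l2 : R).
    exact: cvgD c1 c2.
  have E : \forall ab \near filter_prod (-oo : set_system R) (+oo : set_system R),
      (J \o -%R) ab.1 + I ab.2 = Phi ab.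
    exists ([set x : R | x <= 0], [set y : R | 0 <= y]) => /=.
      by split; [apply: nbhs_ninfty_le|apply: nbhs_pinfty_ge]; exact: num_real.
    by move=> [x y] /= [x0 y0]; rewrite -PhiE.
  have FF : Filter (filter_prod (-oo : set_system R) (+oo : set_system R)).
    exact: filter_prod_filter.
  exact: cvg_trans (@near_eq_cvg _ _ _ FF _ _ E) c12.
split; first split.
- by move=> x y; exact: integrable_continuous_itvcc.
- by apply/cvg_ex; exists (l1 + l2).
have -> : improper_integral h = l1 + l2 by apply/cvg_lim.
apply: le_trans (ler_normD _ _) _; apply: le_trans (lerD ll1 ll2) _.
by rewrite le_eqVlt; apply/orP; left; apply/eqP; ring.
Qed.

End mlf_fourier.

Lemma mlf_norm (R : realType) (a g s : R) : 0 < a ->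
  mittag_leffler a 1 (- g * `|s| `^ a) = mlf a g `|s|.
Proof.
move=> a0; rewrite /mlf; have [s0|s0] := ltP 0 `|s|; first by rewrite ppow_powR.
have -> : `|s| = 0 by apply: le_anti; rewrite s0 normr_ge0.
by rewrite ppow_le0// powR0// gt_eqF.
Qed.

Lemma normc_le_add (R : rcfType) (x y : R) : Normc.normc (x +i* y)%C <= `|x| + `|y|.
Proof.
rewrite /Normc.normc -[leRHS]ger0_norm ?addr_ge0// -[leRHS]sqrtr_sqr ler_wsqrtr//.
have -> : x ^+ 2 = `|x| ^+ 2 by rewrite real_normK// num_real.
have -> : y ^+ 2 = `|y| ^+ 2 by rewrite real_normK// num_real.
by rewrite sqrrD addrAC lerDl mulrn_wge0// mulr_ge0.
Qed.

Theorem mainTheorem6 (R : realType) (alpha theta gamma : R)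
    (alpha_gt0 : 0 < alpha) (alpha_lt1 : alpha < 1)
    (theta_gt0 : 0 < theta) (gamma_gt0 : 0 < gamma)
    (d : measure_display) (T : measurableType d) (P : probability T R)
    (Y : {nonneg R} -> {RV P >-> R})
    (Y_centered : centered_process Y)
    (Y_stationary : stationary_process Y)
    (Y_gaussian : gaussian_process Y)
    (Y_cov : forall (t : {nonneg R}) (s : R) (ts_ge0 : 0 <= t%:num + s),
       covariance P (Y t) (Y (NngNum ts_ge0)) =
       (theta / gamma * mittag_leffler alpha 1 (- gamma * `|s| `^ alpha))%:E) :
  (exists C : R, 0 < C /\
     autocovariance Y s / (C * s `^ (- alpha)) @[s --> +oo] --> (1 : R)) /\
  has_spectral_density Y /\
  (fun w : R => Normc.normc (spectral_density Y w))
    =O_ (0^') (fun w : R => `|w| `^ (alpha - 1)).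
Proof.
pose c := theta / gamma; have c0 : 0 < c by exact: divr_gt0.
have rE s : autocovariance Y s = c * mlf alpha gamma `|s|.
  rewrite -mlf_norm//.
  have s0 : 0 <= (0%:nng : {nonneg R})%:num + `|s| by rewrite add0r.
  have := Y_cov _ _ s0; rewrite normr_id /autocovariance.
  by rewrite (_ : NngNum s0 = `|s|%:nng) => [->//|]; apply/val_inj; rewrite /= add0r.
have Re_integrand w s : complex.Re (fourier_integrand (autocovariance Y) w s) =
    c * cos (- (w * s)) * mlf alpha gamma `|s|.
  by rewrite /fourier_integrand rE /= mulr0 subr0; ring.
have Im_integrand w s : complex.Im (fourier_integrand (autocovariance Y) w s) =
    c * sin (- (w * s)) * mlf alpha gamma `|s|.
  by rewrite /fourier_integrand rE /= mulr0 add0r; ring.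
have dlin (w s : R) : is_derive s 1 (fun s => - (w * s)) (- w).
  have h := is_deriveN (is_deriveZ w (is_derive_id s (1 : R))).
  by apply: is_derive_eq h _; rewrite /GRing.scale/= mulr1.
have clin (w : R) : continuous (fun s : R => - (w * s)).
  by move=> s; exact: is_derive1_cvg (dlin w s).
(* An explicit primitive bounded by c / |w|, which is the gain from oscillation. *)
have Scos (w s : R) : w != 0 -> is_derive s 1 (fun s => - (c / w) * sin (- (w * s))) (c * cos (- (w * s))).
  move=> w0; have h := @is_derive1_comp _ sin (fun s => - (w * s)) s _ _ (is_derive_sin (- (w * s))) (dlin w s).
  by apply: is_derive_eq (is_deriveZ (- (c / w)) h) _; rewrite /GRing.scale/=; field.
have Ssin (w s : R) : w != 0 -> is_derive s 1 (fun s => c / w * cos (- (w * s))) (c * sin (- (w * s))).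
  move=> w0; have h := @is_derive1_comp _ cos (fun s => - (w * s)) s _ _ (is_derive_cos (- (w * s))) (dlin w s).
  by apply: is_derive_eq (is_deriveZ (c / w) h) _; rewrite /GRing.scale/=; field.
have bound (x y : R) : `|x| <= 1 -> `|y * x| <= `|y|.
  by move=> x1; rewrite normrM ler_piMr.
have Ncos (x : R) : `|cos x| <= 1 by rewrite ler_norml cos_geN1 cos_le1.
have Nsin (x : R) : `|sin x| <= 1 by rewrite ler_norml sin_geN1 sin_le1.
have Nc : `|c| = c by rewrite gtr0_norm.
have Ncw (w : R) : `|c / w| = c / `|w| by rewrite normrM normfV Nc.
have Re_bound w : w != 0 -> improper_integrable (fun s => c * cos (- (w * s)) * mlf alpha gamma `|s|) /\
    `|improper_integral (fun s => c * cos (- (w * s)) * mlf alpha gamma `|s|)| <= 6 * c * mlf_bound alpha gamma * `|w| `^ (alpha - 1).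
  move=> w0; apply: (@improper_integral_mlf _ alpha gamma _ _ _ (fun s => c * cos (- (w * s))) (fun s => - (c / w) * sin (- (w * s)))) => //.
  - by move=> s; apply: cvgMr; apply: (@continuous_comp _ _ _ (fun s => - (w * s)) cos); [exact: clin|exact: continuous_cos].
  - by move=> s; exact: Scos.
  - by move=> s; rewrite -[leRHS]Nc bound.
  - by move=> s; rewrite -Ncw mulNr normrN bound.
have Im_bound w : w != 0 -> improper_integrable (fun s => c * sin (- (w * s)) * mlf alpha gamma `|s|) /\
    `|improper_integral (fun s => c * sin (- (w * s)) * mlf alpha gamma `|s|)| <= 6 * c * mlf_bound alpha gamma * `|w| `^ (alpha - 1).
  move=> w0; apply: (@improper_integral_mlf _ alpha gamma _ _ _ (fun s => c * sin (- (w * s))) (fun s => c / w * cos (- (w * s)))) => //.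
  - by move=> s; apply: cvgMr; apply: (@continuous_comp _ _ _ (fun s => - (w * s)) sin); [exact: clin|exact: continuous_sin].
  - by move=> s; exact: Ssin.
  - by move=> s; rewrite -[leRHS]Nc bound.
  - by move=> s; rewrite -Ncw bound.
have ReE w := funext (Re_integrand w); have ImE w := funext (Im_integrand w).
split; last split.
- have G0 := abel_const_gt0 alpha_lt1 gamma_gt0.
  (* The constant is theta / (gamma^2 Gamma(1-alpha)). *)
  exists (c / abel_const alpha gamma); split; first exact: divr_gt0.
  have := mlf_asymptotics alpha_gt0 alpha_lt1 gamma_gt0.
  apply: cvg_trans; apply: near_eq_cvg; near=> s.
  have s0 : 0 < s by near: s; apply: nbhs_pinfty_gt; exact: num_real.
  rewrite rE gtr0_norm//; field.
  by rewrite !gt_eqF// powR_gt0.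
- move=> w w0; split; first by rewrite ReE; case: (Re_bound w w0).
  by rewrite ImE; case: (Im_bound w w0).
- apply/eqO_exP.
  (* 12 = 6 + 6, for the real and the imaginary part. *)
  pose K := 12 * c * mlf_bound alpha gamma.
  have K0 : 0 < K by apply: mulr_gt0; [exact: mulr_gt0|exact: mlf_bound_gt0].
  have pi20 : 0 < (2 * pi : R)^-1 by rewrite invr_gt0 mulr_gt0// pi_gt0.
  exists ((2 * pi)^-1 * K); first by rewrite mulr_gt0.
  near=> w; have w0 : w != 0 by near: w; exact: nbhs_dnbhs_neq.
  have [_ Rew] := Re_bound w w0; have [_ Imw] := Im_bound w w0.
  have n0 z : 0 <= Normc.normc z :> R by case: z => x y; exact: sqrtr_ge0.
  rewrite ger0_norm// [`|_ `^ _|]ger0_norm ?powR_ge0//.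
  rewrite /spectral_density Normc.normcM -mulrA.
  have -> : Normc.normc ((2 * pi)^-1)%:C%C = (2 * pi)^-1 :> R.
    by rewrite /Normc.normc/= expr0n addr0 sqrtr_sqr gtr0_norm.
  rewrite ler_pM2l// /cimproper_integral ReE ImE.
  apply: le_trans (normc_le_add _ _) _; apply: le_trans (lerD Rew Imw) _.
  by rewrite le_eqVlt; apply/orP; left; apply/eqP; rewrite /K; ring.
Unshelve. all: by end_near. Qed.
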